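(* Let $n\geq 2$ be a fixed integer. For every odd prime $p$ let $I_{p^n}$ be a subset of $(\mathbb{Z}/p^n\mathbb{Z})^\times$ such that $$\forall (x,y)\in I_{p^n}\times I_{p^n},\quad x\neq y\Rightarrow p\nmid x-y.$$ On $(\mathbb{Z}/p^n\mathbb{Z})^\times$ endowed with the uniform probability measure, consider the real-valued random variable $$x\longmapsto S\left(\mathsf{Kl}_{p^n},I_{p^n};x\right)\coloneqq\frac{1}{\sqrt{|I_{p^n}|}}\sum_{y\in I_{p^n}}\mathsf{Kl}_{p^n}(y+x).$$ If $p$ and $|I_{p^n}|$ tend to infinity with $\log(|I_{p^n}|)=o(\log p)$, then the random variables $S\left(\mathsf{Kl}_{p^n},I_{p^n};\ast\right)$ converge in law to a real-valued standard Gaussian random variable.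
   Context: For an odd prime $p$, an integer $n\geq 2$ and an integer $a$, the normalized Kloosterman sum is the real number $$\mathsf{Kl}_{p^n}(a)\coloneqq\frac{1}{p^{n/2}}\sum_{\substack{1\leq x\leq p^n\\ p\nmid x}}e\left(\frac{ax+\overline{x}}{p^n}\right),$$ where $e(z)=\exp(2i\pi z)$ and $\overline{x}$ denotes the inverse of $x$ modulo $p^n$. $|I|$ denotes the cardinality of a finite set $I$. *)

(* Defs.v *)
From HB Require Import structures.
From mathcomp Require Import all_boot all_order all_algebra all_fingroup.
From mathcomp Require Import all_classical all_reals all_analysis.
From mathcomp Require Import complex.
From mathcomp Require Import ring lra zify.

Set Implicit Arguments.
Unset Strict Implicit.
Unset Printing Implicit Defensive.

Import Order.TTheory GRing.Theory Num.Theory.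
Import numFieldNormedType.Exports.

Local Open Scope classical_set_scope.
Local Open Scope ring_scope.

Section Kloosterman.
Variable R : realType.

Definition e (t : R) : R[i] := (cos (2 * pi * t) +i* sin (2 * pi * t))%C.

(* [(x%:R : 'Z_q)^-1] is the inverse of [x] modulo [q] when [x] is prime to
   [q] and [1 < q]; it is read as its representative in [0, q). *)
Definition inv_mod (q x : nat) : nat := ((x%:R : 'Z_q)^-1 : 'Z_q).

Definition KlC (p n : nat) (a : int) : R[i] :=
  ((p%:R `^ (n%:R / 2))^-1)%:C%C *
  \sum_(1 <= x < (p ^ n).+1 | ~~ (p %| x)%N)
     e ((a%:~R * x%:R + (inv_mod (p ^ n) x)%:R) / (p ^ n)%:R).

(* The sum [KlC] is real, by [KlC_real] below. *)
Definition Kl (p n : nat) (a : int) : R := complex.Re (KlC p n a).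

Lemma inv_mod_opp (p n x : nat) : prime p -> (0 < n)%N -> ~~ (p %| x)%N ->
  (x < p ^ n)%N ->
  (inv_mod (p ^ n) (p ^ n - x) = p ^ n - inv_mod (p ^ n) x)%N.
Proof.
move=> pp n0 px xq.
have q1 : (1 < p ^ n)%N by rewrite -(exp1n n) ltn_exp2r// prime_gt1.
have x0 : (x%:R : 'Z_(p ^ n))^-1 != 0.
  have : (x%:R : 'Z_(p ^ n)) \is a GRing.unit.
    by rewrite unitZpE// coprimeXl// prime_coprime.
  by rewrite -unitrV; apply: contraTneq => ->; rewrite unitr0.
rewrite /inv_mod natrB 1?ltnW// pchar_Zp// sub0r invrN.
set y := _^-1 in x0 *.
have y0 : (0 < (y : nat))%N by rewrite lt0n; apply: contra x0 => /eqP y0; apply/eqP/val_inj.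
have yq : ((y : nat) < p ^ n)%N by rewrite -[X in (_ < X)%N](Zp_cast q1) ltn_ord.
by rewrite /=; move: (y : nat) y0 yq => z z0 zq; rewrite Zp_cast// modn_small//; lia.
Qed.

Lemma e_int_sub (k : int) (t : R) : e (k%:~R - t) = (e t)^*%C.
Proof.
suff H s : cos (2 * pi * (k%:~R - s)) = cos (2 * pi * s) :> R /\
    sin (2 * pi * (k%:~R - s)) = - sin (2 * pi * s) :> R.
  by rewrite /e /=; case: (H t) => -> ->.
have -> : 2 * pi * (k%:~R - s) = - (2 * pi * s) + (pi *+ 2) *~ k :> R.
  rewrite -[in RHS]mulrzl -mulr_natl; ring.
have per : cos (- (2 * pi * s) + (pi *+ 2) *~ k) = cos (- (2 * pi * s)) :> R /\
   sin (- (2 * pi * s) + (pi *+ 2) *~ k) = sin (- (2 * pi * s)) :> R.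
  have C u m : cos (u + pi *+ 2 *+ m) = cos u :> R.
    elim: m => [|m ih]; first by rewrite mulr0n addr0.
    by rewrite mulrS [pi *+ 2 + _]addrC addrA cosD cos2pi sin2pi mulr1 mulr0 subr0.
  have S u m : sin (u + pi *+ 2 *+ m) = sin u :> R.
    elim: m => [|m ih]; first by rewrite mulr0n addr0.
    by rewrite mulrS [pi *+ 2 + _]addrC addrA sinD cos2pi sin2pi mulr1 mulr0 addr0.
  case: k => m; first by rewrite -pmulrn C S.
  rewrite NegzE mulrNz -pmulrn; set u := - _.
  by rewrite -(C (u - _) m.+1) -(S (u - _) m.+1) subrK.
by case: per => -> ->; rewrite cosN sinN.
Qed.

Lemma KlC_real (p n : nat) (a : int) : prime p -> (0 < n)%N ->
  KlC p n a = (Kl p n a)%:C%C.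
Proof.
move=> pp n0; suff /eqP : (KlC p n a)^*%C = KlC p n a.
  rewrite /Kl; case: (KlC p n a) => u v /=; rewrite eq_complex/= eqxx/= => /eqP v0.
  by congr (_ +i* _)%C; lra.
have q0 : (0 < p ^ n)%N by rewrite expn_gt0 prime_gt0.
rewrite /KlC; set c := _^-1; rewrite rmorphM/=; congr (_ * _).
  by rewrite oppr0.
rewrite rmorph_sum/= big_mkcond big_nat_recr//= dvdn_exp//= addr0.
rewrite [RHS]big_mkcond big_nat_recr//= dvdn_exp//= addr0.
rewrite [RHS]big_nat_rev/=; apply: eq_big_nat => x /andP[x1 xq].
rewrite add1n subSS (dvdn_subr (ltnW xq)) ?dvdn_exp//.
case: ifPn => // px.
rewrite inv_mod_opp//; set t := _ / _.
transitivity (e t)^*%C => //; rewrite -(e_int_sub (a + 1)) /t; congr e.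
have yq : (inv_mod (p ^ n) x <= p ^ n)%N.
  have q1 : (1 < p ^ n)%N by rewrite -(exp1n n) ltn_exp2r// prime_gt1.
  by rewrite ltnW// -[X in (_ < X)%N](Zp_cast q1) ltn_ord.
rewrite (natrB _ (ltnW xq)) (natrB _ yq) intrD; field.
by rewrite pnatr_eq0 -lt0n.
Qed.

End Kloosterman.

(* The type [{unit 'Z_q}] is (Z/qZ)^x for [1 < q] only. *)
Definition unitsZ (q : nat) : Type := {unit 'Z_q}.

HB.instance Definition _ q := Finite.on (unitsZ q).
HB.instance Definition _ q := isPointed.Build (unitsZ q) (1%g : {unit 'Z_q}).
HB.instance Definition _ q := @isMeasurable.Build default_measure_display
  (unitsZ q) discrete_measurable discrete_measurable0
  discrete_measurableC discrete_measurableU.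

Definition unitZ_val (q : nat) (x : unitsZ q) : 'Z_q := FinRing.uval x.

Section uniform_units.
Variables (R : realType) (q : nat).

Definition uniform_units : set (unitsZ q) -> \bar R :=
  mscale (#|{: unitsZ q}|%:R^-1)%:nng (@counting (unitsZ q) R).

HB.instance Definition _ := Measure.on uniform_units.

Let uniform_unitsT : uniform_units [set: unitsZ q] = 1%E.
Proof.
have fT : finite_set [set: unitsZ q] by exact: finite_finset.
rewrite /uniform_units /mscale/= /counting asboolT//.
have -> : size (finmap.enum_fset (fset_set [set: unitsZ q])) = #|{: unitsZ q}|.
  rewrite cardE; apply/perm_size/uniq_perm => [||x].
  - exact: finmap.fset_uniq.
  - exact: enum_uniq.
  - by rewrite (in_fset_set fT) mem_enum in_setT.
rewrite -EFinM mulVf// pnatr_eq0 -lt0n.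
by apply/card_gt0P; exists point.
Qed.

HB.instance Definition _ :=
  Measure_isProbability.Build _ _ _ uniform_units uniform_unitsT.

End uniform_units.

Section sums.
Variables (R : realType) (p n : nat) (I : {set unitsZ (p ^ n)}).

(* [y + x] is a class modulo [p ^ n], possibly not a unit; [Kl p n] is
   evaluated at its representative in [0, p ^ n). *)
Definition sumKl (x : unitsZ (p ^ n)) : R :=
  (Num.sqrt #|I|%:R)^-1 *
  \sum_(y in I) Kl R p n (nat_of_ord (unitZ_val y + unitZ_val x)%R)%:Z.

Let measurable_sumKl : measurable_fun [set: unitsZ (p ^ n)] sumKl.
Proof. by []. Qed.

HB.instance Definition _ := isMeasurableFun.Build _ _ _ _ sumKl measurable_sumKl.

Definition sumKl_RV : {RV (@uniform_units R (p ^ n)) >-> R} := sumKl.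

End sums.

(* The random variables may live on different probability spaces; [mu] is the
   law of the limit. *)
Definition cvg_in_law (R : realType) (J : Type) (F : set_system J)
    (d : J -> measure_display) (T : forall j, measurableType (d j))
    (P : forall j, probability (T j) R) (X : forall j, {RV (P j) >-> R})
    (mu : probability (measurableTypeR R) R) : Prop :=
  forall f : R -> R, continuous f -> bounded_fun f ->
    'E_(P j)[f \o X j]%E @[j --> F] --> 'E_mu[f]%E.

Definition odd_primes : set nat := [set p | prime p && odd p].

Notation odd_primes_oo := (within odd_primes \oo).

(* Main.v *)
(** Averaging over the translations x -> x + p^(n-1) t does not change the law
of the random variable.  Sorting the Kloosterman sum by the residue h of the
summation variable modulo p gives

  Kl(a + p^(n-1) t) = sum over h with h^2 a = 1 (mod p) of c_h(a) chi(h t),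

where |c_h(a)| = 1 and chi is a nontrivial additive character of F_p.  By
orthogonality, for a fixed x the sums over I of the Kl(y + x + p^(n-1) t) have,
as t varies, the same moments of order at most k as the sums of the
independent variables Kl(y + x + p^(n-1) t_y), unless some h_1, ..., h_j with
j <= k and h_i^2 (y_i + x) = 1 (mod p) satisfy a nontrivial additive relation.
Eliminating the square roots h_i from such a relation by a determinant leaves
O(|I|^k) exceptional x modulo p, a negligible proportion because |I|^k is
p^o(1).  For the other x, Taylor's formula compares the characteristic function
with that of the independent model, hence with a Gaussian one whose variance is
the mean over I of the number of h with h^2 (y + x) = 1; this mean has average
1 and variance O(1/|I|) in x.  Characteristic functions control the law
because a continuous function on a segment is close to a Bernstein polynomial
in sin(w x). *)

(* Only moments of a fixed order can be compared, since the bound on the exceptional set for order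
   [k] grows like [|I|^k]; so [k] has to be chosen before [p]. This is affordable because the
   independent model has exponential moments bounded uniformly in [p] and [I]: at parameter 2 they
   bound the Taylor remainders by [4 / 2 ^+ k * expR (32 * l ^+ 2)] at every non-exceptional point.
   The translation by [p^(n-1) t] is the right one because [p^(n-1)] has square zero modulo [p^n],
   so that inversion becomes affine along it. Only the modulus of the coefficients [c_h] matters; it
   comes from a change of variables in the squared sum, where [p] odd enters, and the sums are never
   evaluated. The model is not identically distributed: the number of [h] is 0 or 2 according to the
   residue of [y + x], and its mean over [I] is close to 1 for most [x] only. A pair correlation
   count of square roots controls this fluctuation. Tightness is a separate bound, by second moments
   at the non-exceptional points. *)
Require Import Defs.
From mathcomp Require Import all_boot all_order all_algebra all_fingroup.
From mathcomp Require Import all_classical all_reals all_analysis.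
From mathcomp Require Import complex ring lra zify measurable_realfun.

Set Implicit Arguments.
Unset Strict Implicit.
Unset Printing Implicit Defensive.

Import Order.TTheory GRing.Theory Num.Theory.
Import numFieldNormedType.Exports.

Local Open Scope classical_set_scope.
Local Open Scope ring_scope.


(** * The Kloosterman sum on classes modulo p^(n-1) *)

Section AdditiveCharacter.
Variable R : realType.

Lemma eD (s t : R) : e (s + t) = e s * e t.
Proof.
rewrite /e mulrDr cosD sinD; apply/eqP; rewrite eq_complex /=.
by apply/andP; split; apply/eqP; ring.
Qed.

Lemma e0 : e (0 : R) = 1.
Proof. by rewrite /e mulr0 cos0 sin0. Qed.

Lemma e1 : e (1 : R) = 1.
Proof.
by rewrite /e mulr1 mulr_natl cos2pi sin2pi.
Qed.

Lemma e_nat (m : nat) : e (m%:R : R) = 1.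
Proof. by elim: m => [|m ih]; rewrite ?e0// -[m.+1]addn1 natrD eD ih e1 mul1r. Qed.

Lemma e_neq1 (t : R) : 0 < t < 1 -> e t <> 1.
Proof.
move=> /andP[t0 t1] /eqP; rewrite /e eq_complex /= => /andP[/eqP].
have -> : 2 * pi * t = (pi * t) *+ 2 by rewrite -mulr_natr; ring.
rewrite cos_mulr2n => h _; suff : 0 < sin (pi * t).
  have := cos2Dsin2 (pi * t); nra.
apply: sin_gt0_pi; rewrite mulr_gt0 ?pi_gt0//=.
by rewrite -[X in _ < X]mulr1 ltr_pM2l ?pi_gt0.
Qed.

Variable q : nat.
Hypothesis q1 : (1 < q)%N.
Local Notation A := ('Z_q).

Definition psi (z : A) : R[i] := e ((z : nat)%:R / q%:R).

Lemma qR_neq0 : (q%:R : R) != 0.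
Proof. by rewrite pnatr_eq0 -lt0n ltnW. Qed.

Lemma psi_nat (m : nat) : psi m%:R = e (m%:R / q%:R : R).
Proof.
rewrite /psi val_Zp_nat// [in RHS](divn_eq m q) natrD mulrDl natrM mulfK ?qR_neq0//.
by rewrite eD e_nat mul1r.
Qed.

Lemma psiD (z w : A) : psi (z + w) = psi z * psi w.
Proof.
rewrite [psi z]/psi [psi w]/psi -eD -mulrDl -natrD -psi_nat natrD.
by rewrite !natr_Zp.
Qed.

Lemma psi0 : psi 0 = 1.
Proof. by rewrite /psi mul0r e0. Qed.

Lemma psi_neq1 (z : A) : z != 0 -> psi z != 1.
Proof.
move=> z0; apply/eqP/e_neq1.
have zp : (0 < (z : nat))%N.
  by rewrite lt0n; apply/negP => /eqP zz; case/eqP: z0; exact: val_inj.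
have zq : ((z : nat) < q)%N by rewrite -[X in (_ < X)%N](Zp_cast q1) ltn_ord.
have q0 : 0 < (q%:R : R) by rewrite ltr0n ltnW.
apply/andP; split; first by rewrite divr_gt0// ltr0n.
by rewrite ltr_pdivrMr// mul1r ltr_nat.
Qed.

Lemma psiN (z : A) : psi (- z) = (psi z)^*%C.
Proof.
have h : psi z * (psi z)^*%C = 1.
  rewrite /psi /e; apply/eqP; rewrite eq_complex /=; apply/andP; split; apply/eqP.
    by rewrite mulrN opprK -!expr2 cos2Dsin2.
  by ring.
have pz0 : psi z != 0 by apply/eqP => z0; move: h; rewrite z0 mul0r => /eqP; rewrite eq_sym oner_eq0.
by apply: (mulfI pz0); rewrite h -psiD subrr psi0.
Qed.

Lemma psi_sum (c : A) : \sum_(t : A) psi (c * t) = if c == 0 then q%:R else 0.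
Proof.
case: eqVneq => [->|c0].
  under eq_bigr do rewrite mul0r psi0.
  by rewrite sumr_const card_ord Zp_cast.
have : (\sum_t psi (c * t)) * (psi c - 1) = 0.
  rewrite mulrBr mulr1 mulr_suml [X in _ - X](reindex_inj (addIr 1))/= -sumrB.
  by apply: big1 => t _; rewrite mulrDr mulr1 psiD subrr.
by move/eqP; rewrite mulf_eq0 => /orP[/eqP//|]; rewrite subr_eq0 (negbTE (psi_neq1 c0)).
Qed.

End AdditiveCharacter.

(** * Reduction modulo [p] and the square-zero ideal generated by [p^(n-1)] *)

Section Reduction.
Variables (p n : nat).
Hypotheses (pp : prime p) (n2 : (2 <= n)%N).
Local Notation q := (p ^ n)%N.
Local Notation A := ('Z_q).

Lemma q_gt1 : (1 < q)%N.
Proof. by rewrite -(exp1n n) ltn_exp2r ?prime_gt1// ltnW. Qed.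
Let q1 := q_gt1.

Lemma p_dvd_q : (p %| q)%N.
Proof. by rewrite dvdn_exp// ltnW. Qed.

Definition red (z : A) : 'F_p := (z : nat)%:R.

Lemma natF_eq0 (m : nat) : (m%:R == 0 :> 'F_p) = (p %| m)%N.
Proof. by rewrite -(dvdn_pcharf (pchar_Fp pp)). Qed.

Lemma natF_mod (m : nat) : ((m %% q)%N%:R : 'F_p) = m%:R.
Proof.
rewrite [in RHS](divn_eq m q) natrD natrM.
by rewrite (_ : (q%:R : 'F_p) = 0) ?mulr0 ?add0r//; apply/eqP; rewrite natF_eq0 p_dvd_q.
Qed.

Lemma red_nat (m : nat) : red m%:R = m%:R.
Proof. by rewrite /red val_Zp_nat// natF_mod. Qed.

Lemma red_nat_val (h : 'F_p) : red (h : nat)%:R = h.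
Proof. by rewrite red_nat natr_Zp. Qed.

Lemma redD (z w : A) : red (z + w) = red z + red w.
Proof. by rewrite -[z in LHS]natr_Zp -[w in LHS]natr_Zp -natrD red_nat natrD. Qed.

Lemma redM (z w : A) : red (z * w) = red z * red w.
Proof. by rewrite -[z in LHS]natr_Zp -[w in LHS]natr_Zp -natrM red_nat natrM. Qed.

Lemma red1 : red 1 = 1.
Proof. by rewrite -[1 in LHS]/(1%:R) red_nat. Qed.

Lemma red0 : red 0 = 0.
Proof. by []. Qed.

Lemma redN (z : A) : red (- z) = - red z.
Proof. by apply/eqP; rewrite -addr_eq0 -redD addNr red0. Qed.

Lemma redB (z w : A) : red (z - w) = red z - red w.
Proof. by rewrite redD redN. Qed.

Lemma red_eq0 (z : A) : (red z == 0) = (p %| z)%N.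
Proof. exact: natF_eq0. Qed.

Lemma red_unit (z : A) : (z \is a GRing.unit) = (red z != 0).
Proof.
rewrite red_eq0 -[z in LHS]natr_Zp unitZpE// coprime_pexpl ?prime_coprime//.
by rewrite ltnW.
Qed.

Lemma redV (z : A) : red z != 0 -> red z^-1 = (red z)^-1.
Proof.
move=> z0; apply: (mulfI z0); rewrite -redM divff// divrr ?red1//.
by rewrite red_unit.
Qed.

(* Written [pi] below, where it hides the circle constant. *)
Definition ppi : A := (p ^ n.-1)%:R.

Lemma natA_eq0 (m : nat) : (m%:R == 0 :> A) = (q %| m)%N.
Proof. by rewrite -val_eqE /= val_Zp_nat. Qed.

(** Multiplication by [p^(n-1)] factors through reduction modulo [p] and embeds ['F_p] in [A] as an
    ideal. *)
Lemma ppi_eq0 (z : A) : (ppi * z == 0) = (red z == 0).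
Proof.
rewrite -[z in LHS]natr_Zp -natrM natA_eq0 red_eq0.
move: (nat_of_ord z) => m; have -> : q = (p ^ n.-1 * p)%N by rewrite -expnSr prednK// ltnW.
by rewrite dvdn_pmul2l// expn_gt0 prime_gt0.
Qed.

(** Here [n >= 2] is essential: it gives [2 (n - 1) >= n]. *)
Lemma ppi_sqr : ppi * ppi = 0.
Proof. by apply/eqP; rewrite -natrM natA_eq0 -expnD dvdn_exp2l//; lia. Qed.

Lemma red_ppi : red ppi = 0.
Proof. by apply/eqP; rewrite -ppi_eq0 ppi_sqr. Qed.

Lemma card_dvd_ord (d m N : nat) : (0 < d)%N -> N = (d * m)%N ->
  #|[set i : 'I_N | (d %| i)%N]%SET| = m.
Proof.
move=> d0 ->; rewrite -sum1_card big_mkcond /=; under eq_bigr do rewrite inE.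
rewrite -(big_mkord xpredT (fun i => if (d %| i)%N then 1%N else 0%N)).
elim: m => [|m ih]; first by rewrite muln0 big_nil.
rewrite mulnS addnC (big_cat_nat (n := d * m)) ?leq_addr//= ih -{1}(add0n (d * m)%N) big_addn addKn.
rewrite -(prednK d0) big_nat_recl//= add0n dvdn_mulr// big_nat big1 ?addn0 ?addn1// => i /andP[_ id].
rewrite dvdn_addl ?dvdn_mulr// ifF// gtnNdvd//; lia.
Qed.

Lemma card_red0 : #|[set z : A | red z == 0]%SET| = (p ^ n.-1)%N.
Proof.
have -> : [set z : A | red z == 0]%SET = [set z : A | (p %| z)%N]%SET.
  by apply/finset.setP => z; rewrite !inE red_eq0.
apply: card_dvd_ord; first exact: prime_gt0.
by rewrite Zp_cast// -expnS prednK// ltnW.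
Qed.

Lemma card_red (h : 'F_p) : #|[set z : A | red z == h]%SET| = (p ^ n.-1)%N.
Proof.
rewrite -card_red0 -(card_imset _ (addrI (- (h : nat)%:R))).
apply: eq_card => z; rewrite [RHS]inE; apply/imsetP/idP.
  by move=> [w]; rewrite inE => /eqP hw ->; rewrite redD redN red_nat_val hw addNr.
move=> /eqP z0; exists ((h : nat)%:R + z); last by rewrite addKr.
by rewrite inE redD red_nat_val z0 addr0.
Qed.

Lemma card_ppi0 : #|[set z : A | p%:R * z == 0]%SET| = p.
Proof.
have -> : [set z : A | p%:R * z == 0]%SET = [set z : A | (p ^ n.-1 %| z)%N]%SET.
  apply/finset.setP => z; rewrite !inE -[z in LHS]natr_Zp -natrM natA_eq0.
  move: (nat_of_ord z) => m; have -> : q = (p * p ^ n.-1)%N by rewrite -expnS prednK// ltnW.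
  by rewrite dvdn_pmul2l ?prime_gt0.
apply: card_dvd_ord; first by rewrite expn_gt0 prime_gt0.
by rewrite Zp_cast// mulnC -expnS prednK// ltnW.
Qed.

End Reduction.

(** * Stationary phase on the fibres of reduction modulo [p] *)

Section KloostermanFibers.
Variables (R : realType) (p n : nat).
Hypotheses (pp : prime p) (n2 : (2 <= n)%N).
Local Notation q := (p ^ n)%N.
Local Notation A := ('Z_q).
Let q1 := q_gt1 pp n2.
Local Notation psi := (@psi R q).
Local Notation pi := (ppi p n).
Local Notation red := (@red p n).

(** The restriction of [psi] to the ideal generated by [p^(n-1)], read as a character of ['F_p]. *)
Definition chi (h : 'F_p) : R[i] := psi (pi * (h : nat)%:R).

Lemma psi_ppi (z : A) : psi (pi * z) = chi (red z).
Proof.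
rewrite /chi; congr psi; apply/eqP; rewrite -subr_eq0 -mulrBr ppi_eq0//.
by rewrite redB// red_nat_val// subrr.
Qed.

Lemma chiD (h k : 'F_p) : chi (h + k) = chi h * chi k.
Proof. by rewrite -(red_nat_val pp n2 h) -(red_nat_val pp n2 k) -redD// -!psi_ppi mulrDr psiD. Qed.

Lemma chi0 : chi 0 = 1.
Proof. by rewrite /chi mulr0 psi0. Qed.

Lemma chi_neq1 (h : 'F_p) : h != 0 -> chi h != 1.
Proof. by move=> h0; apply: psi_neq1 => //; rewrite ppi_eq0// red_nat_val. Qed.

Lemma chi_sum (h : 'F_p) : \sum_(t : A) chi (red t * h) = if h == 0 then q%:R else 0.
Proof.
rewrite -(red_nat_val pp n2 h) -(ppi_eq0 pp n2) -psi_sum//; apply: eq_bigr => t _.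
by rewrite -redM// -psi_ppi; congr psi; ring.
Qed.

Definition fiberS (h : 'F_p) (a : A) : R[i] :=
  \sum_(x : A | red x == h) psi (a * x + x^-1).

(** The first order expansion of the inverse is exact because [pi * pi = 0]. *)
Lemma ppi_inv (x v : A) : red x != 0 -> (x + pi * v)^-1 = x^-1 - x^-1 * x^-1 * (pi * v).
Proof.
move=> x0; have ux : x \is a GRing.unit by rewrite red_unit.
have ux' : x + pi * v \is a GRing.unit.
  by rewrite red_unit// redD// redM// red_ppi// mul0r addr0.
apply: (mulrI ux'); rewrite divrr//; set y := x^-1.
have xy : x * y = 1 by rewrite divrr.
have pp0 := ppi_sqr pp n2.
transitivity (x * y + (1 - x * y) * (pi * v) * y  - y * y * (pi * pi) * v * v); first by rewrite xy pp0; ring.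
ring.
Qed.

(** The phase [a * x + x^-1] has derivative [a - x^-2], nonzero modulo [p] on this fibre. A
    translation by a multiple of [pi] preserves the fibre and multiplies the sum by a nontrivial
    value of [chi]. *)
Lemma fiberS_eq0 (h : 'F_p) (a : A) : h != 0 -> h ^+ 2 * red a != 1 -> fiberS h a = 0.
Proof.
move=> h0 ha; pose d := red a - h^-1 * h^-1.
have d0 : d != 0.
  apply: contra ha; rewrite subr_eq0 => /eqP ->.
  by rewrite expr2 mulrA mulfK// divff.
(* A lift of [d^-1], which makes the factor produced by the translation equal to [chi 1]. *)
pose v : A := (d^-1 : 'F_p)%:R.
have key : fiberS h a = chi 1 * fiberS h a.
  rewrite {1}/fiberS (reindex_inj (addIr (pi * v)))/= /fiberS mulr_sumr.
  apply: eq_big => x; first by rewrite redD// redM// red_ppi// mul0r addr0.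
  move=> /eqP hx; have {}hx : red x = h by rewrite -hx redD// redM// red_ppi// mul0r addr0.
  have x0 : red x != 0 by rewrite hx.
  rewrite ppi_inv// (_ : a * _ + _ = pi * (v * (a - x^-1 * x^-1)) + (a * x + x^-1)); last by ring.
  rewrite psiD// psi_ppi redM// redB// redM// redV// hx red_nat_val// mulVf//.
apply/eqP; move/eqP: key; rewrite -subr_eq0 -{1}[fiberS h a]mul1r -mulrBl mulf_eq0 => /orP[|//].
by rewrite subr_eq0 eq_sym (negbTE (chi_neq1 _))// oner_eq0.
Qed.

Lemma sum_ideal (z : A) :
  \sum_(y : A | red y == 0) psi (z * y) = if p%:R * z == 0 then (p ^ n.-1)%N%:R else 0.
Proof.
case: eqVneq => [z0|z0].
  rewrite (eq_bigr (fun=> 1)) => [|y]; first by rewrite sumr_const -cardsE card_red0.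
  rewrite red_eq0// => /dvdnP[m hm].
  by rewrite -[y]natr_Zp hm natrM mulrCA [z * _]mulrC z0 mulr0 psi0.
have : (\sum_(y : A | red y == 0) psi (z * y)) * (psi (p%:R * z) - 1) = 0.
  rewrite mulrBr mulr1 mulr_suml [X in _ - X](reindex_inj (addIr p%:R))/=.
  rewrite [X in _ - X](eq_bigl (fun y => red y == 0)); last first.
    by move=> y; rewrite redD// red_nat// pchar_Fp_0// addr0.
  by rewrite -sumrB big1// => t _; rewrite mulrDr psiD// [z * p%:R]mulrC subrr.
by move/eqP; rewrite mulf_eq0 => /orP[/eqP//|]; rewrite subr_eq0 (negbTE (psi_neq1 R q1 z0)).
Qed.

(** The inner sum is [p^(n-1)] when [p] kills [z] and 0 otherwise. The [p] elements killed by [p]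
    all reduce to 0, because [n >= 2]. *)
Lemma sum_ideal2 : \sum_(z : A | red z == 0) \sum_(y : A | red y == 0) psi (z * y) = q%:R.
Proof.
under eq_bigr do rewrite sum_ideal.
rewrite -big_mkcondr /= (eq_bigl (fun z => p%:R * z == 0)); last first.
  move=> z; rewrite andb_idl// => /eqP z0; rewrite -(ppi_eq0 pp n2) /ppi.
  by rewrite -(@prednK n.-1) 1?expnSr ?natrM -?mulrA ?z0 ?mulr0//; lia.
rewrite sumr_const -cardsE (card_ppi0 pp n2) -mulrnA -expnSr.
by have -> : n.-1.+1 = n by case: (n) n2.
Qed.

(** The map [x |-> a * x - x^-1 * w^-1] is a bijection from the fibre over [h] onto the multiples of
    [p]: it is injective, takes values there since [h] is a critical point, and both sets have
    [p^(n-1)] elements. *)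
Lemma sum_fiber_phase (h : 'F_p) (a w : A) (G : A -> R[i]) : odd p ->
  h ^+ 2 * red a = 1 -> red w = 1 ->
  \sum_(x : A | red x == h) G (a * x - x^-1 * w^-1) = \sum_(y : A | red y == 0) G y.
Proof.
move=> op ha hw.
have h0 : h != 0 by apply/eqP => h0; move/eqP: ha; rewrite h0 expr0n mul0r eq_sym oner_eq0.
have w0 : red w != 0 by rewrite hw oner_eq0.
have ra : red a = h^-1 * h^-1.
  apply: (mulfI (expf_neq0 2 h0)); rewrite ha expr2 mulrA mulfK// divff//.
pose f (x : A) : A := a * x - x^-1 * w^-1.
pose D := [set x : A | red x == h]%SET.
have injf : {in D &, injective f}.
  move=> x y; rewrite !inE => /eqP hx /eqP hy fxy.
  have ux : x \is a GRing.unit by rewrite red_unit// hx.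
  have uy : y \is a GRing.unit by rewrite red_unit// hy.
  (* This is the quotient of [f x - f y] by [x - y]; it reduces to [2 * h^-2], nonzero because [p]
     is odd. *)
  have uu : a + x^-1 * y^-1 * w^-1 \is a GRing.unit.
    rewrite red_unit// redD// !redM// !redV ?hx ?hy// hw invr1 mulr1 ra -mulr2n -mulr_natr.
    rewrite !mulf_neq0 ?invr_eq0// natF_eq0//; apply/negP => /(dvdn_leq (isT : (0 < 2)%N)) p2.
    by have := prime_gt1 pp; move: op p2; case: (p) => [|[|[|]]].
  apply/eqP; rewrite -subr_eq0; apply/eqP; apply: (mulIr uu); rewrite mul0r.
  have xx : x * x^-1 = 1 by rewrite divrr.
  have yy : y * y^-1 = 1 by rewrite divrr.
  transitivity (f x - f y + (x * x^-1 - 1) * y^-1 * w^-1 - (y * y^-1 - 1) * x^-1 * w^-1); first by rewrite /f; ring.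
  by rewrite fxy xx yy; ring.
transitivity (\sum_(y in f @: D) G y).
  by rewrite big_imset//=; apply: eq_bigl => x; rewrite inE.
have -> : (f @: D)%SET = [set y : A | red y == 0]%SET.
  apply/eqP; rewrite eqEcard; apply/andP; split; last first.
    by rewrite card_in_imset// card_red// card_red.
  apply/fintype.subsetP => y /imsetP[x xD yE]; move: xD; rewrite !inE => /eqP hx; rewrite yE /f.
  have x0 : red x != 0 by rewrite hx.
  by rewrite redB// !redM// (redV pp n2 x0) (redV pp n2 w0) hw hx invr1 mulr1 ra -mulrA mulVf// mulr1 subrr.
by apply: eq_bigl => y; rewrite inE.
Qed.

(** In the squared modulus, the second variable is written [x * w] with [w] congruent to 1. The
    difference of the phases then factors as [(1 - w) * (a * x - x^-1 * w^-1)], and both factors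
    range over the multiples of [p], which leads to [sum_ideal2]. *)
Lemma fiberS_norm (h : 'F_p) (a : A) : odd p -> h ^+ 2 * red a = 1 ->
  fiberS h a * (fiberS h a)^*%C = q%:R.
Proof.
move=> op ha.
have h0 : h != 0 by apply/eqP => h0; move/eqP: ha; rewrite h0 expr0n mul0r eq_sym oner_eq0.
rewrite /fiberS rmorph_sum mulr_suml.
transitivity (\sum_(x : A | red x == h) \sum_(w : A | red w == 1)
   psi ((1 - w) * (a * x - x^-1 * w^-1))).
  apply: eq_bigr => x /eqP hx; rewrite mulr_sumr.
  have ux : x \is a GRing.unit by rewrite red_unit// hx.
  rewrite (reindex_inj (mulrI ux)); apply: eq_big => w.
    by rewrite redM// hx -{2}[h]mulr1 (inj_eq (mulfI h0)).
  move=> /eqP hw; have w1 : red w = 1 by apply: (mulfI h0); rewrite mulr1 -{1}hx -redM// hw.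
  have uw : w \is a GRing.unit by rewrite red_unit// w1 oner_eq0.
  transitivity (psi (a * x + x^-1) * psi (- (a * (x * w) + (x * w)^-1))); first by rewrite psiN.
  rewrite -psiD// invrM//; congr psi.
  have ww : w * w^-1 = 1 by rewrite divrr.
  transitivity (a * x - a * x * w + (w * w^-1) * x^-1 - x^-1 * w^-1); first by rewrite ww; ring.
  by ring.
rewrite exchange_big/=.
transitivity (\sum_(w : A | red w == 1) \sum_(y : A | red y == 0) psi ((1 - w) * y)).
  by apply: eq_bigr => w /eqP hw; exact: (sum_fiber_phase (fun y => psi ((1 - w) * y))).
rewrite -sum_ideal2 (reindex_inj (inj_comp (addrI 1) oppr_inj))/=.
apply: eq_big => z; first by rewrite redB// red1// -subr_eq0 addrAC subrr add0r oppr_eq0.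
by move=> _; apply: eq_bigr => y _; rewrite opprB addrCA subrr addr0.
Qed.

End KloostermanFibers.

Section SquareRoots.
Variable F : finFieldType.

(** The number of critical points modulo [p] of the phase [a * x + x^-1], for [a] reducing to
    [u]. *)
Definition nroot (u : F) : nat := #|[set h : F | h ^+ 2 * u == 1]%SET|.

Lemma nroot_le2 (u : F) : (nroot u <= 2)%N.
Proof.
rewrite /nroot; case: (pickP [pred h : F | h ^+ 2 * u == 1]) => [h /= /eqP hu|h0]; last first.
  by rewrite eq_card0// => h; rewrite inE; exact: h0.
apply: (@leq_trans #|[set h; - h]%SET|); last by rewrite cards2; case: (_ != _).
apply: subset_leq_card.
apply/fintype.subsetP => k; rewrite !inE => /eqP ku.
have u0 : u != 0 by apply/eqP => u0; move/eqP: ku; rewrite u0 mulr0 eq_sym oner_eq0.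
by rewrite -eqf_sqr; apply/eqP; apply: (mulIf u0); rewrite hu.
Qed.

End SquareRoots.

Section KloostermanValues.
Variables (R : realType) (p n : nat).
Hypotheses (pp : prime p) (op : odd p) (n2 : (2 <= n)%N).
Local Notation q := (p ^ n)%N.
Local Notation A := ('Z_q).
Let q1 := q_gt1 pp n2.
Local Notation psi := (@psi R q).
Local Notation pi := (ppi p n).
Local Notation red := (@red p n).
Local Notation chi := (@chi R p n).
Local Notation kl b := (Kl R p n (nat_of_ord (b : A)%R)%:Z).

Definition klnorm : R := p%:R `^ (n%:R / 2).

Lemma klnorm_sqr : klnorm ^+ 2 = q%:R.
Proof. by rewrite -powR_mulrn ?powR_ge0// -powRrM mulfVK// powR_mulrn// natrX. Qed.

Definition klcoef (h : 'F_p) (a : A) : R[i] := (klnorm^-1)%:C%C * fiberS R h a.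

Lemma klcoef_norm (h : 'F_p) (a : A) : h ^+ 2 * red a = 1 ->
  klcoef h a * (klcoef h a)^*%C = 1.
Proof.
move=> ha; rewrite /klcoef rmorphM /= mulrACA fiberS_norm// oppr0.
have -> : (klnorm^-1 +i* 0)%C = (klnorm^-1)%:C%C by [].
rewrite -rmorphM/= -invfM -expr2 klnorm_sqr.
have -> : (q%:R : R[i]) = (q%:R)%:C%C by rewrite rmorph_nat.
by rewrite -rmorphM/= mulVf// pnatr_eq0 -lt0n ltnW.
Qed.

Lemma KlC_sum (a : A) :
  KlC R p n (a : nat)%:Z = (klnorm^-1)%:C%C * \sum_(x : A | red x != 0) psi (a * x + x^-1).
Proof.
rewrite /KlC; congr (_ * _).
(* The index [q] contributes nothing, and neither would 0: the range from 1 to [q] becomes the set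
   of representatives in [[0, q)]. *)
rewrite big_mkcond big_nat_recr ?expn_gt0 ?prime_gt0//= p_dvd_q//= addr0.
rewrite [RHS]big_mkcond/=.
pose F (x : nat) := if ~~ (p %| x)%N then psi (a * x%:R + (x%:R)^-1) else 0.
transitivity (\sum_(0 <= x < q) F x).
  rewrite [RHS]big_ltn; last by rewrite ltnW.
  rewrite {1}/F dvdn0 add0r; apply: eq_big_nat => x _; rewrite /F; case: ifP => // px.
  transitivity (psi ((a * x + inv_mod q x)%N%:R)); first by rewrite psi_nat// natrD natrM.
  by rewrite natrD natrM natr_Zp /inv_mod natr_Zp.
rewrite -[X in \sum_(0 <= x < X) _](Zp_cast q1) big_mkord.
by apply: eq_bigr => x _; rewrite /F red_eq0// natr_Zp.
Qed.

(** The product [pi * t * x] depends on [x] modulo [p] only, so the shift multiplies the whole fibre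
    over [h] by [chi (red t * h)]; the non-critical fibres vanish. *)
Lemma Kl_shift (a t : A) :
  (kl (a + pi * t))%:C%C =
  \sum_(h : 'F_p | h ^+ 2 * red a == 1) klcoef h a * chi (red t * h).
Proof.
rewrite -KlC_real// 1?ltnW// KlC_sum (partition_big red (fun h => h != 0))//=.
rewrite big_mkcond [in RHS]big_mkcond mulr_sumr; apply: eq_bigr => h _.
transitivity (if h != 0 then klcoef h a * chi (red t * h) else 0).
  case: ifPn => h0; last by rewrite mulr0.
  rewrite -mulrA; congr (_ * _); rewrite /fiberS mulr_suml; apply: eq_big.
    by move=> x; rewrite andb_idl// => /eqP ->.
  move=> x /andP[_ /eqP hx]; rewrite -hx -redM// -psi_ppi// -psiD//; congr psi; ring.
have [->|h0] := eqVneq h 0; first by rewrite expr2 !mul0r eq_sym oner_eq0.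
by case: eqVneq => // ha; rewrite /klcoef fiberS_eq0// mulr0 mul0r.
Qed.

(** There are at most two critical points, each contributing a number of modulus 1. *)
Lemma Kl_shift_le2 (a t : A) : `|kl (a + pi * t)| <= 2.
Proof.
have h : `|(kl (a + pi * t))%:C%C| <= 2 :> R[i].
  rewrite Kl_shift; apply: le_trans (ler_norm_sum _ _ _) _.
  apply: (@le_trans _ _ (\sum_(h : 'F_p | h ^+ 2 * red a == 1) 1)); last first.
    by rewrite sumr_const -cardsE ler_nat; exact: nroot_le2.
  apply: ler_sum => h /eqP ha.
  have nchi (z : A) : `|psi z| = 1.
    have : psi z * (psi z)^*%C = 1 by rewrite -psiN// -psiD// subrr psi0.
    by rewrite -[RHS](expr1n _ 2) -normCK => /eqP; rewrite eqrXn2// => /eqP.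
  rewrite normrM nchi mulr1 -(@ler_pXn2r _ 2)// ?nnegrE// normCK expr1n.
  by rewrite klcoef_norm.
by move: h; rewrite normc_def/= expr0n/= addr0 sqrtr_sqr -(rmorph_nat (real_complex R)) lecR.
Qed.

Lemma Kl_shift_sum (a : A) : \sum_(t : A) kl (a + pi * t) = 0.
Proof.
apply: (fmorph_inj (real_complex R)); rewrite rmorph0 rmorph_sum/=.
under eq_bigr do rewrite Kl_shift.
rewrite exchange_big/= big1// => h /eqP ha; rewrite -mulr_sumr chi_sum//.
case: eqVneq => [h0|]; last by rewrite mulr0.
by move/eqP: ha; rewrite h0 expr0n mul0r eq_sym oner_eq0.
Qed.

Lemma Kl_shift_sum_sqr (a : A) :
  \sum_(t : A) (kl (a + pi * t)) ^+ 2 = q%:R * (nroot (red a))%:R.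
Proof.
apply: (fmorph_inj (real_complex R)); rewrite rmorph_sum rmorphM !rmorph_nat/=.
transitivity (\sum_(t : A) \sum_(h : 'F_p | h ^+ 2 * red a == 1) \sum_(k : 'F_p | k ^+ 2 * red a == 1)
   klcoef h a * (klcoef k a)^*%C * chi (red t * (h - k))).
  apply: eq_bigr => t _; rewrite expr2 rmorphM/=.
  (* The sum being real, one factor of its square may be conjugated, so that orthogonality selects
     [h = k] rather than [h = - k]. *)
  have hc (r : R) : r%:C%C = (r%:C)^*%C by rewrite /= oppr0.
  rewrite [X in _ * X]hc Kl_shift rmorph_sum mulr_suml; apply: eq_bigr => h _.
  rewrite mulr_sumr; apply: eq_bigr => k _.
  rewrite rmorphM mulrACA; congr (_ * _).
  transitivity (chi (red t * h) * chi (- (red t * k))); last by rewrite -chiD// mulrBr.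
  congr (_ * _); rewrite -[in RHS](red_nat_val pp n2 k) -redM// -redN// -psi_ppi// mulrN psiN//.
  by rewrite psi_ppi// redM// red_nat_val.
rewrite exchange_big/=.
transitivity (\sum_(h : 'F_p | h ^+ 2 * red a == 1) (q%:R : R[i])).
  apply: eq_bigr => h ha; rewrite exchange_big/= (bigD1 h)//= -mulr_sumr chi_sum// subrr eqxx.
  rewrite klcoef_norm ?mul1r ?big1 ?addr0//; last exact/eqP.
  move=> k /andP[_ kh]; rewrite -mulr_sumr chi_sum// subr_eq0 eq_sym (negbTE kh) mulr0//.
by rewrite sumr_const -cardsE mulr_natr.
Qed.

End KloostermanValues.

(** * Elimination of square roots *)

Section Elimination.
Variable F : fieldType.
Implicit Types (c w : {poly F}) (ws : seq {poly F}).

Fixpoint elim_dim ws : nat := if ws is _ :: ws' then (elim_dim ws' + elim_dim ws')%N else 1%N.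

(* At a point [x], the eigenvalues of [elim_mx c ws] are [c.[x]] plus all the
   sums of square roots of the [w.[x]], [w] in [ws]. *)
Fixpoint elim_mx c ws : 'M[{poly F}]_(elim_dim ws) :=
  if ws is w :: ws' then block_mx (elim_mx c ws') 1%:M w%:M (elim_mx c ws') else c%:M.

Lemma elim_dimE ws : elim_dim ws = (2 ^ size ws)%N.
Proof. by elim: ws => //= w ws ->; rewrite expnS mul2n addnn. Qed.

(** If [v] is a left eigenvector of the smaller matrix for [r] and [s ^+ 2 = w.[x]], then
    [(s *: v, v)] is one of the block matrix for [r + s]: each radicand adds the companion matrix of
    [X^2 - w] as a Kronecker summand. *)
Lemma elim_mx_eigen c ws (x : F) (ss : seq F) :
  all2 (fun s w => s ^+ 2 == w.[x]) ss ws ->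
  exists2 v : 'rV[F]_(elim_dim ws), v != 0 &
    v *m map_mx (horner_eval x) (elim_mx c ws) = (c.[x] + \sum_(s <- ss) s) *: v.
Proof.
elim: ws ss => [|w ws ih] [|s ss]//=.
  move=> _; exists 1%:M; first exact: oner_neq0.
  by rewrite big_nil addr0 mul1mx map_scalar_mx scalemx1.
move=> /andP[/eqP sw /ih[v v0 hv]]; exists (row_mx (s *: v) v).
  by rewrite row_mx_eq0 negb_and v0 orbT.
rewrite map_block_mx !map_scalar_mx /= (rmorph1 (horner_eval x)) mul_row_block -!scalemxAl hv mul_mx_scalar mulmx1.
rewrite big_cons scale_row_mx /horner_eval -sw; congr row_mx.
  by rewrite !scalerA -scalerDl; congr (_ *: _); ring.
by rewrite -scalerDl; congr (_ *: _); ring.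
Qed.

(** Where the radicands vanish the blocks are triangular. This is what certifies that the
    determinant is not the zero polynomial. *)
Lemma elim_det_eval c ws (a : F) : all (fun w => w.[a] == 0) ws ->
  (\det (elim_mx c ws)).[a] = c.[a] ^+ elim_dim ws.
Proof.
elim: ws => [|w ws ih] /=; first by rewrite det_scalar !expr1.
move=> /andP[/eqP wa /ih{}ih]; rewrite -[LHS]/(horner_eval a _) -det_map_mx map_block_mx !map_scalar_mx /= (rmorph1 (horner_eval a)).
rewrite (_ : horner_eval a w = 0)// raddf0 det_ublock det_map_mx.
by rewrite /= /horner_eval ih exprD.
Qed.

Lemma size_det (n D : nat) (M : 'M[{poly F}]_n) :
  (forall i j, (size (M i j) <= D.+1)%N) -> (size (\det M) <= (n * D).+1)%N.
Proof.
move=> hM; apply: leq_trans (size_sum _ _ _) _; apply/bigmax_leqP => s _.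
rewrite mulrC -signr_odd; apply: leq_trans (_ : (size (\prod_i M i (s i))%R <= _)%N).
  by case: odd; rewrite ?expr1 ?expr0 ?mulrN1 ?mulr1 ?size_polyN.
apply: leq_trans (size_poly_prod_leq _ _) _; rewrite leq_subLR.
apply: leq_trans (_ : (\sum_(i < n) D.+1).+1 <= _)%N; first by rewrite ltnS leq_sum.
by rewrite sum_nat_const card_ord mulnS addnS.
Qed.

Lemma elim_mx_size c ws (D : nat) : (size c <= D.+1)%N -> all (fun w => size w <= D.+1)%N ws ->
  forall i j, (size (elim_mx c ws i j) <= D.+1)%N.
Proof.
move=> hc; elim: ws => [|w ws ih] /=.
  by move=> _ i j; rewrite mxE; case: (_ == _); rewrite ?mulr1n ?mulr0n ?size_poly0.
move=> /andP[hw /ih{}ih] i j; rewrite mxE; case: splitP => i' _; rewrite mxE; case: splitP => j' _ //.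
  by rewrite mxE; case: (_ == _); rewrite ?mulr1n ?mulr0n ?size_poly0 ?size_poly1.
by rewrite mxE; case: (_ == _); rewrite ?mulr1n ?mulr0n ?size_poly0.
Qed.

(** The witness is the determinant of [elim_mx]: a vanishing combination of square roots is a zero
    eigenvalue at [x], while at [a] every eigenvalue is [c.[a]]. *)
Lemma elimination c ws (a : F) (D : nat) : c.[a] != 0 -> all (fun w => w.[a] == 0) ws ->
  (size c <= D.+1)%N -> all (fun w => size w <= D.+1)%N ws ->
  exists G : {poly F}, [/\ G != 0, (size G <= (2 ^ size ws * D).+1)%N &
    forall (x : F) (ss : seq F), all2 (fun s w => s ^+ 2 == w.[x]) ss ws ->
      c.[x] + \sum_(s <- ss) s = 0 -> root G x].
Proof.
move=> ca wa sc sw; exists (\det (elim_mx c ws)); split.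
- apply/eqP => d0; have := elim_det_eval c wa; rewrite d0 horner0 => /esym/eqP.
  by rewrite expf_eq0 (negbTE ca) andbF.
- by rewrite -elim_dimE; apply: size_det; exact: elim_mx_size.
- move=> x ss hss h0; have [v v0] := elim_mx_eigen c hss.
  rewrite h0 scale0r => hv; rewrite /root -[X in X == 0]/(horner_eval x _) -det_map_mx.
  by apply/det0P; exists v.
Qed.

End Elimination.

Lemma card_cover (T K : finType) (A : {set T}) (B : K -> {set T}) :
  (forall x, x \in A -> exists k, x \in B k) -> (#|A| <= \sum_k #|B k|)%N.
Proof.
move=> hAB; rewrite -sum1_card.
apply: (@leq_trans (\sum_(x in A) \sum_k (x \in B k))%N).
  by apply: leq_sum => x /hAB[k xk]; rewrite (bigD1 k)//= xk.
rewrite exchange_big /=; apply: leq_sum => k _.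
rewrite -sum1_card [leqRHS]big_mkcond [leqLHS]big_mkcond /=; apply: leq_sum => x _.
by do 2 case: ifP.
Qed.

Lemma card_roots (F : finFieldType) (G : {poly F}) : G != 0 ->
  (#|[set x : F | root G x]%SET| < size G)%N.
Proof.
move=> G0; rewrite cardE; apply: max_poly_roots => //; last exact: enum_uniq.
by apply/allP => x; rewrite mem_enum inE.
Qed.

Section Relations.
Variable F : finFieldType.

(** The number of pairs of a base index and a sign pattern, times the degree bound of the
    eliminating polynomial. *)
Definition relation_const (j : nat) : nat := (j * 2 ^ j * (2 ^ j * (2 * j)))%N.

(** The family [u] may have repetitions. A relation that already holds within each class of equal
    [u i] is shared by the independent model; the last condition excludes it. *)
Definition bad_pts (j : nat) (u : 'I_j -> F) : {set F} :=
  [set x : F | [exists h : {ffun 'I_j -> F},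
     [&& [forall i, h i ^+ 2 * (u i + x) == 1], \sum_i h i == 0 &
         [exists i0, \sum_(i | u i == u i0) h i != 0]]]]%SET.

Lemma horner_prod_seq (T : Type) (S : seq T) (f : T -> {poly F}) (x : F) :
  (\prod_(i <- S) f i).[x] = \prod_(i <- S) (f i).[x].
Proof. by elim/big_rec2: _ => [|i y z _ <-]; rewrite ?hornerC// hornerM. Qed.

(** Divided by [h i0], the relation becomes [m] plus a sum of square roots of
    [(u i0 + x) / (u i + x)] over the indices outside the class of [i0]. These radicands vanish at
    [- u i0], where [m] survives: [elimination] applies once [D S] has cleared the denominators. *)
Lemma relation_poly (j : nat) (u : 'I_j -> F) (i0 : 'I_j) (m : F) : m != 0 ->
  exists G : {poly F}, [/\ G != 0, (size G <= (2 ^ j * (2 * j)).+1)%N &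
    forall (x : F) (h : 'I_j -> F), (forall i, h i ^+ 2 * (u i + x) = 1) ->
      \sum_i h i = 0 -> \sum_(i | u i == u i0) h i = m * h i0 -> root G x].
Proof.
move=> m0; pose S := [seq i <- enum 'I_j | u i != u i0].
have sS : (size S < j)%N.
  rewrite size_filter; apply: (@leq_trans (size (enum 'I_j))); last by rewrite size_enum_ord.
  rewrite ltn_neqAle count_size andbT -all_count; apply/negP => /allP/(_ i0).
  by rewrite mem_enum eqxx => /(_ isT).
pose D (s : seq 'I_j) : {poly F} := \prod_(i <- s) ('X - (- u i)%:P).
have szD s : size (D s) = (size s).+1 by rewrite size_prod_XsubC.
have evD s x : (D s).[x] = \prod_(i <- s) (x + u i).
  by rewrite horner_prod_seq; apply: eq_bigr => i _; rewrite hornerXsubC opprK.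
(* The square of [d * h i / h i0], with [d] the value of [D S], is the value of
   the polynomial [w i]; all the [w i] vanish at [- u i0], but [D S] does not. *)
pose w i := D S * ('X - (- u i0)%:P) * D (rem i S).
have [||||G [G0 sG hG]] := @elimination F (m *: D S) (map w S) (- u i0) (2 * j).
- rewrite hornerZ mulf_neq0// evD big_seq prodf_seq_neq0; apply/allP => i iS; apply/implyP => _.
  by move: iS; rewrite mem_filter addrC subr_eq0 => /andP[].
- by apply/allP => _ /mapP[i _ ->]; rewrite !hornerM hornerXsubC opprK addNr mulr0 mul0r.
- apply: leq_trans (size_scale_leq _ _) _; rewrite szD; lia.
- apply/allP => _ /mapP[i iS ->]; apply: leq_trans (size_polyMleq _ _) _.
  rewrite szD size_rem//; have := size_polyMleq (D S) ('X - (- u i0)%:P).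
  rewrite size_XsubC szD; move: sS; move: (size S) (size (D S * _)) => b c; lia.
exists G; split=> //.
  apply: leq_trans sG _; rewrite ltnS leq_mul2r size_map leq_exp2l//; apply/orP; right; exact: ltnW.
move=> x h hh hs hm; have hn0 i : h i != 0.
  by apply/eqP => h0; move/eqP: (hh i); rewrite h0 expr2 !mul0r eq_sym oner_eq0.
have hu i : u i + x = (h i)^-1 ^+ 2.
  by apply: (mulfI (expf_neq0 2 (hn0 i))); rewrite hh -exprMn divff ?expr1n.
pose d := \prod_(i <- S) (x + u i).
apply: (hG x [seq d * h i / h i0 | i <- S]).
  rewrite all2E !size_map eqxx /= zip_map all_map; apply/allP => k kS /=.
  rewrite !hornerM hornerXsubC opprK !evD -/d.
  have -> : d = (x + u k) * \prod_(i <- rem k S) (x + u i).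
    by rewrite /d (perm_big _ (perm_to_rem kS)) big_cons.
  have hk := hh k; set r := \prod_(i <- _) _.
  by rewrite [x + u k]addrC [x + u i0]addrC !hu; apply/eqP; field; rewrite !hn0.
rewrite hornerZ evD -/d big_map -mulr_suml -mulr_sumr.
have -> : \sum_(i <- S) h i = - (m * h i0).
  apply/eqP; rewrite -addr_eq0 -hm addrC -[eqbRHS]hs [eqbRHS](bigID (fun i => u i == u i0)) /=.
  by rewrite big_filter big_enum_cond.
by field; rewrite hn0.
Qed.

(** Within the class of [i0] the roots are [h i0] up to sign, so the class sum is [h i0] times the
    signed count [m]. A nontrivial relation has [m != 0] in [F] for some [i0], and the polynomial
    depends only on [i0] and on the signs. *)
Lemma card_bad_pts (j : nat) (u : 'I_j -> F) : (#|bad_pts u| <= relation_const j)%N.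
Proof.
pose m (k : 'I_j * {ffun 'I_j -> bool}) : F := \sum_(i | u i == u k.1) (-1) ^+ k.2 i.
have P k : exists B : {set F}, (#|B| <= 2 ^ j * (2 * j))%N /\ (m k != 0 ->
    forall (x : F) (h : 'I_j -> F), (forall i, h i ^+ 2 * (u i + x) = 1) ->
      \sum_i h i = 0 -> \sum_(i | u i == u k.1) h i = m k * h k.1 -> x \in B).
  have [mk|mk] := eqVneq (m k) 0; first by exists finset.set0; rewrite cards0 mk; split=> //; rewrite eqxx.
  have [G [G0 sG hG]] := relation_poly u k.1 mk.
  exists [set x | root G x]%SET; split.
    by rewrite -ltnS; apply: leq_trans (card_roots G0) _.
  by move=> _ x h h1 h2 h3; rewrite inE; exact: hG h3.
have /choice[B hB] := P.
apply: (@leq_trans (\sum_k #|B k|)%N).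
  apply: card_cover => x; rewrite inE => /existsP[h /and3P[/forallP hh /eqP hs /existsP[i0 hi0]]].
  pose k := (i0, [ffun i => h i != h i0]).
  have {}hh i : h i ^+ 2 * (u i + x) = 1 by exact/eqP.
  have hm : \sum_(i | u i == u i0) h i = m k * h i0.
    rewrite /m mulr_suml; apply: eq_bigr => i /eqP ui; rewrite /k/= ffunE.
    have : h i ^+ 2 == h i0 ^+ 2.
      have ux : u i0 + x != 0 by apply/eqP => e; move/eqP: (hh i0); rewrite e mulr0 eq_sym oner_eq0.
      by apply/eqP; apply: (mulIf ux); rewrite hh -ui hh.
    by rewrite eqf_sqr; case: eqVneq => [->|_ /= /eqP ->]; rewrite ?expr0 ?mul1r ?expr1 ?mulN1r.
  exists k; refine ((hB k).2 _ x h hh hs hm).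
  by apply: contra hi0 => /eqP mk; rewrite hm mk mul0r.
apply: (@leq_trans (\sum_(k : 'I_j * {ffun 'I_j -> bool}) 2 ^ j * (2 * j))%N).
  by apply: leq_sum => k _; exact: (hB k).1.
by rewrite sum_nat_const card_prod card_ord card_ffun card_bool card_ord.
Qed.

End Relations.

(** * Comparison with a sum of independent variables *)

Section Taylor.
Variable R : realType.
Implicit Types c x : R.

(* The Taylor polynomial of [cos (c + x)] at [x = 0]: the [j]-th derivative of
   [cos] is [cos] translated by [j * pi / 2]. *)
Definition cosT (k : nat) c x : R :=
  \sum_(j < k) cos (c + j%:R * (pi / 2)) * (x ^+ j / (j`!)%:R).

Lemma is_derive_monomial (a : R) (j : nat) x :
  is_derive x 1 (fun y : R => a * y ^+ j) (a * (x ^+ j.-1 *+ j)).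
Proof.
have := is_deriveZ a (is_deriveX j (is_derive_id x 1)).
rewrite (_ : a \*: _ = (fun y : R => a * y ^+ j)); last first.
  by apply/funext => y; rewrite exprfctE.
by rewrite -[x ^+ j.-1 *+ j]mulr_natl /GRing.scale/= mulr1.
Qed.

Lemma is_derive_cosT (k : nat) c x :
  is_derive x 1 (cosT k.+1 c) (cosT k (c + pi / 2) x).
Proof.
have -> : cosT k.+1 c = \sum_(j < k.+1) (fun x => cos (c + j%:R * (pi / 2)) * (x ^+ j / (j`!)%:R)).
  by apply/funext => y; rewrite fct_sumE.
have -> : cosT k (c + pi / 2) x =
    \sum_(j < k.+1) cos (c + j%:R * (pi / 2)) * (x ^+ j.-1 *+ j / (j`!)%:R).
  rewrite big_ord_recl /= mulr0n !mul0r mulr0 add0r; apply: eq_bigr => j _.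
  rewrite /bump /= add1n -[X in cos (c + X * _)]natr1; congr (_ * _); first by congr cos; ring.
  rewrite add0n -[X in _ = X / _]mulr_natr factS natrM.
  have kn : (j.+1%:R : R) != 0 by rewrite pnatr_eq0.
  have fn : ((j`!)%:R : R) != 0 by rewrite pnatr_eq0 -lt0n fact_gt0.
  by move: kn fn; move: (j.+1%:R : R) ((j`!)%:R : R) => a b kn fn; field; rewrite kn fn.
apply: is_derive_sum => j.
have := is_derive_monomial (cos (c + j%:R * (pi / 2)) / (j`!)%:R) j x.
rewrite (_ : (fun y => _) = (fun y => cos (c + j%:R * (pi / 2)) * (y ^+ j / (j`!)%:R))).
  by rewrite -!mulrA [_^-1 * _]mulrC.
by apply/funext => y; rewrite -mulrA [_^-1 * _]mulrC.
Qed.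

Lemma ge0_of_derive (f df : R -> R) x : 0 <= x ->
  (forall y : R, is_derive y 1 f (df y)) -> (forall y, 0 <= y -> 0 <= df y) -> f 0 <= f x.
Proof.
move=> x0 fd df0; rewrite -subr_ge0.
have [|y] := @MVT_segment R f df 0 x x0 (fun y _ => fd y).
  by apply: derivable_within_continuous => y _; case: (fd y).
by rewrite in_itv/= => /andP[y0 _] ->; rewrite mulr_ge0 ?df0// subr0.
Qed.

(** The error at order [k.+1] vanishes at 0, and its derivative is the error at order [k] with [c]
    translated by [pi / 2]; the induction integrates the bound. *)
Lemma cos_le_cosT (k : nat) c x : 0 <= x -> cos (c + x) - cosT k c x <= x ^+ k / (k`!)%:R.
Proof.
elim: k c x => [|k ih] c x x0.
  by rewrite /cosT big_ord0 subr0 expr0 fact0 divr1 cos_le1.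
rewrite -subr_ge0.
pose f y : R := (k.+1`!)%:R^-1 * y ^+ k.+1 - (cos (c + y) - cosT k.+1 c y).
pose df y : R := y ^+ k / (k`!)%:R - (cos (c + pi / 2 + y) - cosT k (c + pi / 2) y).
have f0 : f 0 = 0.
  rewrite /f /cosT big_ord_recl/= expr0n/= mulr0 addr0 mul0r addr0 expr0 fact0 divr1 mulr1.
  by rewrite big1 ?addr0 ?subrr// => j _; rewrite expr0n/= mul0r mulr0.
rewrite -[X in X <= _]f0 [_ / _]mulrC; apply: (@ge0_of_derive f df) => // y.
  have h := is_derive_cosT k c y.
  have hl : is_derive y 1 (fun y : R => c + y) 1.
    by have := is_deriveD (is_derive_cst c y 1) (is_derive_id y 1); rewrite add0r.
  have hc : is_derive y 1 (fun y : R => cos (c + y)) (- sin (c + y)).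
    by have := is_derive1_comp (is_derive_cos (c + y)) hl; rewrite mulr1.
  have := is_deriveB (is_derive_monomial (k.+1`!)%:R^-1 k.+1 y) (is_deriveB hc h).
  rewrite /df (_ : cos (c + pi / 2 + y) = - sin (c + y)); last by rewrite addrAC cosDpihalf.
  rewrite (_ : _^-1 * _ = y ^+ k / (k`!)%:R)// -[X in _ * X]mulr_natr factS natrM /=.
  have kn : (k.+1%:R : R) != 0 by rewrite pnatr_eq0.
  have fn : ((k`!)%:R : R) != 0 by rewrite pnatr_eq0 -lt0n fact_gt0.
  by move: kn fn; move: (k.+1%:R : R) ((k`!)%:R : R) => a b kn fn; field; rewrite kn fn.
by move=> y0; rewrite /df subr_ge0 ih.
Qed.

Lemma cosTpi (k : nat) c x : cosT k (c + pi) x = - cosT k c x.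
Proof.
rewrite /cosT -sumrN; apply: eq_bigr => j _; rewrite -mulNr; congr (_ * _).
by rewrite addrAC cosDpi.
Qed.

Lemma cosTN (k : nat) c x : cosT k (- c) (- x) = cosT k c x.
Proof.
rewrite /cosT; apply: eq_bigr => j _; rewrite exprNn -[_ * x ^+ j / _]mulrA mulrA; congr (_ * _); rewrite -[RHS]cosN opprD.
move: (nat_of_ord j) => m; elim: m c => [|m ih] c; first by rewrite expr0 !mul0r mulr1 oppr0.
rewrite -addn1 natrD exprD expr1.
rewrite (_ : - c + _ = - (c - pi / 2) + m%:R * (pi / 2)); last by ring.
rewrite [_ * (_ * -1)]mulrA ih mulrN1.
rewrite (_ : - (c - pi / 2) - m%:R * (pi / 2) = - c - (m%:R + 1) * (pi / 2) + pi); last by field.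
by rewrite cosDpi opprK.
Qed.

(** The lower bound is the upper one at [c + pi]; negative [x] reduces to positive [x] by parity. *)
Lemma cos_taylor (k : nat) c x : `|cos (c + x) - cosT k c x| <= `|x| ^+ k / (k`!)%:R.
Proof.
wlog x0 : c x / 0 <= x => [hw|].
  have [/hw//|xN] := leP 0 x.
  by rewrite -cosTN -cosN opprD -(normrN x); apply: hw; rewrite oppr_ge0 ltW.
rewrite (ger0_norm x0) ler_norml cos_le_cosT// andbT lerNl opprB.
have := @cos_le_cosT k (c + pi) x x0; rewrite cosTpi addrAC cosDpi; lra.
Qed.

Lemma cos_taylor3 x : `|cos x - (1 - x ^+ 2 / 2)| <= `|x| ^+ 3 / 6.
Proof.
have := cos_taylor 3 0 x; rewrite add0r (_ : cosT 3 0 x = 1 - x ^+ 2 / 2)//.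
rewrite /cosT !big_ord_recr big_ord0 /= !add0r mul0r cos0 mul1r [1%:R * _]mul1r cos_pihalf mul0r addr0.
have -> : (2%:R : R) * (pi / 2) = pi by field.
by rewrite cospi expr0 invr1 mulr1 mulN1r.
Qed.

Lemma sin_taylor3 x : `|sin x - x| <= `|x| ^+ 3 / 6.
Proof.
have := cos_taylor 3 (- (pi / 2)) x; rewrite /cosT !big_ord_recr big_ord0 /= !add0r mul0r addr0.
have -> : - (pi / 2) + (1%:R : R) * (pi / 2) = 0 by ring.
have -> : - (pi / 2) + (2%:R : R) * (pi / 2) = pi / 2 by field.
by rewrite cosN cos0 cos_pihalf !mul0r add0r addr0 mul1r [- _ + x]addrC cosBpihalf divr1.
Qed.

(** From [1 - x <= expR (- x)] comes [expR x <= (1 - x)^-1], which lies below the quadratic for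
    these [x]. *)
Lemma expR_le_quadratic x : `|x| <= 1 / 2 -> expR x <= 1 + x + 2 * x ^+ 2.
Proof.
rewrite ler_norml => /andP[x1 x2]; have h := expR_ge1Dx (- x).
have h2 : expR x * expR (- x) = 1 by rewrite -expRD subrr expR0.
have := expR_gt0 x; nra.
Qed.

Lemma expRN_taylor x : 0 <= x -> `|expR (- x) - (1 - x)| <= x ^+ 2.
Proof.
move=> x0; have h := expR_ge1Dx (- x); have h1 := expR_ge1Dx x.
have h2 : expR x * expR (- x) = 1 by rewrite -expRD subrr expR0.
rewrite ger0_norm ?subr_ge0//; have := expR_gt0 (- x); nra.
Qed.

Lemma pow_fact_le_expR (k : nat) x : ~~ odd k -> x ^+ k / (k`!)%:R <= expR x + expR (- x).
Proof.
wlog x0 : x / 0 <= x => [hw|] ek.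
  have [x0|/ltW x0] := leP 0 x; first exact: hw.
  by have := hw (- x); rewrite oppr_ge0 opprK exprNn -signr_odd (negbTE ek) expr0 mul1r addrC; apply.
apply: (@le_trans _ _ (expR x)); last by rewrite lerDl expR_ge0.
case: k ek => [|k] _; first by rewrite expr0 fact0 divr1 -expR0 ler_expR.
by have := expR_ge1Dxn k x0; lra.
Qed.

End Taylor.

Section Average.
Variable K : numFieldType.

(** Expectation under the uniform law. Independent variables are modelled by the coordinates of a
    function type, with [avg_prod] as the statement of independence. *)
Definition avg (X : finType) (f : X -> K) : K := (#|X|%:R)^-1 * \sum_x f x.

Lemma eq_avg (X : finType) (f g : X -> K) : f =1 g -> avg f = avg g.
Proof. by move=> fg; rewrite /avg; congr (_ * _); apply: eq_bigr => x _; rewrite fg. Qed.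

Lemma avgD (X : finType) (f g : X -> K) : avg (fun x => f x + g x) = avg f + avg g.
Proof. by rewrite /avg big_split mulrDr. Qed.

Lemma avgZ (X : finType) (k : K) (f : X -> K) : avg (fun x => k * f x) = k * avg f.
Proof. by rewrite /avg -mulr_sumr mulrCA. Qed.

Lemma avgB (X : finType) (f g : X -> K) : avg (fun x => f x - g x) = avg f - avg g.
Proof. by rewrite -[- avg g]mulN1r -avgZ -avgD; apply: eq_avg => x; rewrite mulN1r. Qed.

Lemma avg_sum (X : finType) (J : finType) (f : J -> X -> K) :
  avg (fun x => \sum_j f j x) = \sum_j avg (f j).
Proof. by rewrite /avg exchange_big mulr_sumr. Qed.

Lemma avg_cst (X : finType) (k : K) : (0 < #|X|)%N -> avg (fun _ : X => k) = k.
Proof. by move=> X0; rewrite /avg sumr_const -[k *+ _]mulr_natl mulKf// pnatr_eq0 -lt0n. Qed.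

Lemma le_avg (X : finType) (f g : X -> K) : (forall x, f x <= g x) -> avg f <= avg g.
Proof. by move=> fg; rewrite /avg ler_wpM2l ?invr_ge0// ler_sum. Qed.

Lemma ler_norm_avg (X : finType) (f : X -> K) : `|avg f| <= avg (fun x => `|f x|).
Proof. by rewrite /avg normrM ger0_norm ?invr_ge0// ler_wpM2l ?invr_ge0// ler_norm_sum. Qed.

Lemma avg_exchange (X Y : finType) (f : X -> Y -> K) :
  avg (fun x => avg (fun y => f x y)) = avg (fun y => avg (fun x => f x y)).
Proof. by rewrite /avg -mulr_sumr -[in RHS]mulr_sumr exchange_big/= mulrCA. Qed.

Lemma avg_prod (T A : finType) (F : T -> A -> K) :
  avg (fun r : {ffun T -> A} => \prod_y F y (r y)) = \prod_y avg (F y).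
Proof.
rewrite {1}/avg -bigA_distr_bigA /= big_split/= prodfV prodr_const card_ffun natrX.
by congr (_ ^- _ * _); apply: eq_card.
Qed.

(** One factor is replaced at a time; the bound on the product of the [w y] is carried along the
    induction. *)
Lemma ler_dist_prod (T : finType) (z w : T -> K) :
  (forall y, `|z y| <= 1) -> (forall y, `|w y| <= 1) ->
  `|\prod_y z y - \prod_y w y| <= \sum_y `|z y - w y|.
Proof.
move=> z1 w1.
suff [] : `|\prod_y z y - \prod_y w y| <= \sum_y `|z y - w y| /\ `|\prod_y w y| <= 1 by [].
pose P (a b c : K) := `|a - b| <= c /\ `|b| <= 1.
elim: (index_enum T) => [|y s [ih1 ih2]].
  by rewrite !big_nil subrr normr0 normr1.
rewrite !big_cons; split; last by rewrite normrM mulr_ile1.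
set a := \prod_(j <- s) z j in ih1 *; set b := \prod_(j <- s) w j in ih1 ih2 *.
have -> : z y * a - w y * b = (z y - w y) * b + z y * (a - b) by ring.
apply: le_trans (ler_normD _ _) _; rewrite !normrM; apply: lerD.
  by rewrite ler_piMr.
by apply: le_trans ih1; rewrite ler_piMl.
Qed.

End Average.

Section Cis.
Variable R : realType.
Implicit Types x y c : R.

Definition cis x : R[i] := (cos x +i* sin x)%C.

Lemma cisD x y : cis (x + y) = cis x * cis y.
Proof.
rewrite /cis cosD sinD; apply/eqP; rewrite eq_complex /=.
by apply/andP; split; apply/eqP; ring.
Qed.

Lemma cis0 : cis 0 = 1.
Proof. by rewrite /cis cos0 sin0. Qed.

Lemma cis_sum (T : finType) (f : T -> R) : cis (\sum_y f y) = \prod_y cis (f y).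
Proof. exact: (big_morph cis cisD cis0). Qed.

Lemma norm_cis x : `|cis x| = 1.
Proof. by rewrite normc_def/= cos2Dsin2 sqrtr1. Qed.

Lemma Re_sum (X : finType) (f : X -> R[i]) :
  complex.Re (\sum_x f x) = \sum_x complex.Re (f x).
Proof. by apply: (big_morph (@complex.Re R)) => //= -[a b] [c d]. Qed.

Lemma Im_sum (X : finType) (f : X -> R[i]) :
  complex.Im (\sum_x f x) = \sum_x complex.Im (f x).
Proof. by apply: (big_morph (@complex.Im R)) => //= -[a b] [c d]. Qed.

Lemma Re_avg (X : finType) (f : X -> R[i]) :
  complex.Re (avg f) = avg (fun z => complex.Re (f z)).
Proof.
rewrite /avg -Re_sum -[(#|X|%:R : R[i])](rmorph_nat (real_complex R)) -fmorphV.
by case: (\sum_x f x) => a b /=; rewrite mul0r subr0.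
Qed.

Lemma Im_avg (X : finType) (f : X -> R[i]) :
  complex.Im (avg f) = avg (fun z => complex.Im (f z)).
Proof.
rewrite /avg -Im_sum -[(#|X|%:R : R[i])](rmorph_nat (real_complex R)) -fmorphV.
by case: (\sum_x f x) => a b /=; rewrite mul0r addr0.
Qed.

Lemma normc_le (z : R[i]) (a b : R) :
  `|complex.Re z| <= a -> `|complex.Im z| <= b -> `|z| <= (a + b)%:C%C.
Proof.
move=> za zb; rewrite normc_def lecR; apply: le_trans (lerD za zb).
rewrite -[leRHS]ger0_norm ?addr_ge0// -sqrtr_sqr ler_wsqrtr//.
rewrite sqrrD !real_normK ?num_real// -addrA [X in _ <= _ + X]addrC addrA lerDl.
by rewrite mulrn_wge0// mulr_ge0.
Qed.

Lemma Re_le_norm (z : R[i]) (a : R) : `|z| <= a%:C%C -> `|complex.Re z| <= a.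
Proof.
rewrite normc_def lecR; apply: le_trans.
by rewrite -sqrtr_sqr ler_wsqrtr// lerDl sqr_ge0.
Qed.

End Cis.

(** * Sums at a common point against sums at independent points, with equal low moments *)

Section Model.
Variables (R : realType) (T A : finType) (Z : T -> A -> R) (b : T -> R) (k : nat).
Hypotheses (A0 : (0 < #|A|)%N) (Zb : forall y a, `|Z y a| <= b y)
  (b4 : forall y, b y <= 1 / 4) (Z0 : forall y, avg (Z y) = 0) (ek : ~~ odd k).
Let S (a : A) : R := \sum_y Z y a.
Let S' (r : {ffun T -> A}) : R := \sum_y Z y (r y).
Hypothesis moments : forall j, (j <= k)%N -> avg (fun a => S a ^+ j) = avg (fun r => S' r ^+ j).
Let v (y : T) : R := avg (fun a => Z y a ^+ 2).

Let b0 y : 0 <= b y.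
Proof. by have [a _] := card_gt0P A0; exact: le_trans (Zb y a). Qed.

(** Each factor is centred, hence at most [1 + 2 * (2 * b y) ^+ 2 <= expR (8 * b y ^+ 2)]. The
    hypothesis [b y <= 1 / 4] keeps [s * Z y a] in the range of the quadratic bound. *)
Lemma model_expR (s : R) : `|s| <= 2 ->
  avg (fun r => expR (s * S' r)) <= expR (8 * \sum_y b y ^+ 2).
Proof.
move=> s2; have -> : avg (fun r => expR (s * S' r)) = \prod_y avg (fun a => expR (s * Z y a)).
  rewrite -avg_prod; apply: eq_avg => r; rewrite mulr_sumr.
  exact: (big_morph (@expR R) (@expRD R) (@expR0 R)).
rewrite mulr_sumr (big_morph (@expR R) (@expRD R) (@expR0 R)).
apply: ler_prod => y _; apply/andP; split.
  by rewrite /avg mulr_ge0 ?invr_ge0// sumr_ge0// => a _; exact: expR_ge0.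
apply: (@le_trans _ _ (avg (fun a => (1 + 8 * b y ^+ 2) + s * Z y a))).
  apply: le_avg => a; have sz : `|s * Z y a| <= 2 * b y.
    by rewrite normrM ler_pM.
  have hs : `|s * Z y a| <= 1 / 2 by apply: le_trans sz _; have := b4 y; lra.
  apply: le_trans (expR_le_quadratic hs) _.
  have : (s * Z y a) ^+ 2 <= 4 * b y ^+ 2.
    rewrite -real_normK ?num_real//; apply: le_trans (_ : (2 * b y) ^+ 2 <= _).
      by rewrite ler_pXn2r// ?nnegrE// mulr_ge0.
    by rewrite exprMn; lra.
  lra.
by rewrite avgD avgZ Z0 mulr0 addr0 avg_cst// expR_ge1Dx.
Qed.

(** Taking [x = 2 * S' r] in [pow_fact_le_expR] produces the gain [2 ^- k]; parameter 1 would give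
    no decay in [k]. *)
Lemma model_moment : avg (fun r => S' r ^+ k) <=
  2 * (k`!)%:R / 2 ^+ k * expR (8 * \sum_y b y ^+ 2).
Proof.
have f0 : (0 : R) < (k`!)%:R by rewrite ltr0n fact_gt0.
have t0 : (0 : R) < 2 ^+ k by rewrite exprn_gt0.
have h1 := @model_expR 2; have h2 := @model_expR (- 2).
have h : avg (fun r => (2 * S' r) ^+ k / (k`!)%:R) <=
    avg (fun r => expR (2 * S' r) + expR (- 2 * S' r)).
  by apply: le_avg => r; rewrite mulNr; exact: pow_fact_le_expR.
rewrite avgD in h.
have -> : avg (fun r => S' r ^+ k) = (k`!)%:R / 2 ^+ k * avg (fun r => (2 * S' r) ^+ k / (k`!)%:R).
  rewrite -avgZ; apply: eq_avg => r; rewrite exprMn; field.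
  by rewrite !gt_eqF.
have -> : 2 * (k`!)%:R / 2 ^+ k * expR (8 * \sum_y b y ^+ 2) =
   (k`!)%:R / 2 ^+ k * (expR (8 * \sum_y b y ^+ 2) + expR (8 * \sum_y b y ^+ 2)) by ring.
rewrite ler_pM2l ?divr_gt0//; apply: le_trans h _; apply: lerD; [apply: h1|apply: h2].
  by rewrite ger0_norm.
by rewrite normrN ger0_norm.
Qed.

(** Both averages have the same Taylor polynomial, and each remainder is bounded by the moment of
    order [k], which is again common; [k] even removes the absolute values. *)
Lemma moment_cos (c : R) :
  `|avg (fun a => cos (c + S a)) - avg (fun r => cos (c + S' r))| <=
  4 / 2 ^+ k * expR (8 * \sum_y b y ^+ 2).
Proof.
have f0 : (0 : R) < (k`!)%:R by rewrite ltr0n fact_gt0.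
have tay (X : finType) (f : X -> R) : `|avg (fun x => cos (c + f x)) - avg (fun x => cosT k c (f x))|
    <= (k`!)%:R^-1 * avg (fun x => f x ^+ k).
  rewrite -avgB; apply: le_trans (ler_norm_avg _) _; rewrite -avgZ; apply: le_avg => x.
  apply: le_trans (cos_taylor _ _ _) _.
  by rewrite mulrC -normrX ger0_norm ?exprn_even_ge0.
have eqT : avg (fun a => cosT k c (S a)) = avg (fun r => cosT k c (S' r)).
  rewrite /cosT !avg_sum; apply: eq_bigr => j _; rewrite !avgZ; congr (_ * _).
  transitivity ((j`!)%:R^-1 * avg (fun a => S a ^+ j)).
    by rewrite -avgZ; apply: eq_avg => a; rewrite mulrC.
  rewrite (moments (ltnW (ltn_ord j))) -avgZ; apply: eq_avg => r; exact: mulrC.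
have h1 := tay _ S; have h2 := tay _ S'; rewrite eqT (moments (leqnn k)) in h1.
have mm : (k`!)%:R^-1 * avg (fun x => S' x ^+ k) <= 2 / 2 ^+ k * expR (8 * \sum_y b y ^+ 2).
  rewrite ler_pdivrMl//; apply: le_trans model_moment _.
  by rewrite le_eqVlt; apply/orP; left; apply/eqP; ring.
have -> : 4 / 2 ^+ k * expR (8 * \sum_y b y ^+ 2) =
   2 / 2 ^+ k * expR (8 * \sum_y b y ^+ 2) + 2 / 2 ^+ k * expR (8 * \sum_y b y ^+ 2) by ring.
set a1 := avg _ in h1 *; set a2 := avg (fun r => cos _) in h2 *; set t := avg (fun _ => cosT _ _ _) in h1 h2.
have -> : a1 - a2 = (a1 - t) - (a2 - t) by ring.
apply: le_trans (ler_normB _ _) _; apply: lerD; [exact: le_trans h1 mm|exact: le_trans h2 mm].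
Qed.

Lemma model_cis (y : T) : `|avg (fun a => cis (Z y a)) - (expR (- (v y / 2)))%:C%C| <= (b y ^+ 3)%:C%C.
Proof.
have bb := b0 y; have bq := b4 y.
have v0 : 0 <= v y by rewrite /v /avg mulr_ge0 ?invr_ge0// sumr_ge0// => a _; exact: sqr_ge0.
have vb : v y <= b y ^+ 2.
  rewrite -[leRHS](@avg_cst R A)//; apply: le_avg => a.
  by rewrite -real_normK ?num_real// ler_pXn2r// nnegrE.
have b3 (a : A) : `|Z y a| ^+ 3 / 6 <= b y ^+ 3 / 6 by rewrite ler_pM2r ?invr_gt0// ler_pXn2r// nnegrE.
(* The three shares are for the cosine, for the exponential of the variance, and for the sine, whose
   linear term averages to 0. *)
have -> : b y ^+ 3 = (b y ^+ 3 / 6 + b y ^+ 3 * (2 / 3)) + b y ^+ 3 / 6 by field.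
apply: normc_le.
  rewrite raddfB /= Re_avg /=.
  have h1 : `|avg (fun a => cos (Z y a)) - (1 - v y / 2)| <= b y ^+ 3 / 6.
    have -> : 1 - v y / 2 = avg (fun a => 1 - Z y a ^+ 2 / 2).
      rewrite avgB avg_cst//; congr (_ - _); rewrite mulrC -avgZ.
      by apply: eq_avg => a; rewrite mulrC.
    rewrite -avgB; apply: le_trans (ler_norm_avg _) _; rewrite -[leRHS](@avg_cst R A)//; apply: le_avg => a.
    exact: le_trans (cos_taylor3 _) (b3 a).
  have h2 : `|expR (- (v y / 2)) - (1 - v y / 2)| <= b y ^+ 3 * (2 / 3).
    apply: le_trans (@expRN_taylor _ _ _) _; first by rewrite divr_ge0.
    have : (v y / 2) ^+ 2 <= (b y ^+ 2 / 2) ^+ 2 by rewrite ler_pXn2r ?nnegrE ?divr_ge0 ?sqr_ge0// ler_pM2r.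
    have : b y ^+ 3 * b y <= b y ^+ 3 by rewrite ler_piMr ?exprn_ge0//; lra.
    have := exprn_ge0 3 bb; have -> : (b y ^+ 2 / 2) ^+ 2 = b y ^+ 3 * b y / 4 by field.
    lra.
  have -> : avg (fun x => cos (Z y x)) - expR (- (v y / 2)) =
     (avg (fun x => cos (Z y x)) - (1 - v y / 2)) - (expR (- (v y / 2)) - (1 - v y / 2)) by ring.
  by apply: le_trans (ler_normB _ _) _; exact: lerD.
rewrite raddfB /= Im_avg /= subr0 -[X in `|X|]subr0 -(Z0 y) -avgB.
apply: le_trans (ler_norm_avg _) _; rewrite -[leRHS](@avg_cst R A)//; apply: le_avg => a.
exact: le_trans (sin_taylor3 _) (b3 a).
Qed.

Lemma model_cos (c : R) :
  `|avg (fun r => cos (c + S' r)) - cos c * expR (- (\sum_y v y / 2))| <= \sum_y b y ^+ 3.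
Proof.
have -> : avg (fun r => cos (c + S' r)) = complex.Re (cis c * \prod_y avg (fun a => cis (Z y a))).
  rewrite -avg_prod -avgZ Re_avg; apply: eq_avg => r.
  by rewrite -cis_sum -cisD.
have -> : cos c * expR (- (\sum_y v y / 2)) = complex.Re (cis c * \prod_y (expR (- (v y / 2)))%:C%C).
  rewrite -rmorph_prod -sumrN (big_morph (@expR R) (@expRD R) (@expR0 R)) /=.
  by rewrite mulr0 subr0.
rewrite -raddfB -mulrBr; apply: Re_le_norm; rewrite normrM norm_cis mul1r.
apply: le_trans (ler_dist_prod _ _) _.
- move=> y; apply: le_trans (ler_norm_avg _) _; under eq_avg do rewrite norm_cis.
  by rewrite avg_cst.
- move=> y; rewrite normc_def/= expr0n/= addr0 sqrtr_sqr.
  have -> : (1 : R[i]) = 1%:C%C by [].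
  rewrite lecR.
  rewrite ger0_norm ?expR_ge0// -[leRHS]expR0 ler_expR oppr_le0 divr_ge0//.
  by rewrite /v /avg mulr_ge0 ?invr_ge0// sumr_ge0// => a _; exact: sqr_ge0.
- rewrite rmorph_sum; apply: ler_sum => y _; exact: model_cis.
Qed.

Lemma moment_model_cos (c : R) :
  `|avg (fun a => cos (c + S a)) - cos c * expR (- (\sum_y v y / 2))| <=
  4 / 2 ^+ k * expR (8 * \sum_y b y ^+ 2) + \sum_y b y ^+ 3.
Proof.
have -> : avg (fun a => cos (c + S a)) - cos c * expR (- (\sum_y v y / 2)) =
  (avg (fun a => cos (c + S a)) - avg (fun r => cos (c + S' r))) +
  (avg (fun r => cos (c + S' r)) - cos c * expR (- (\sum_y v y / 2))) by ring.
apply: le_trans (ler_normD _ _) _; apply: lerD; [exact: moment_cos|exact: model_cos].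
Qed.

End Model.

(** * The Gaussian characteristic function *)

Section GaussianIntegrals.
Variable R : realType.
Local Notation mu := (@lebesgue_measure R).

Lemma is_derive_continuous (f df : R -> R) :
  (forall x : R, is_derive x 1 f (df x)) -> continuous f.
Proof.
move=> fd x; apply: differentiable_continuous; apply/derivable1_diffP.
by case: (fd x).
Qed.

Definition gauss (x : R) : R := normal_peak 1 * expR (- (x ^+ 2 / 2)).

Lemma normal_pdf01 : normal_pdf (0 : R) 1 = gauss.
Proof.
apply/funext => x; rewrite normal_pdfE ?oner_neq0// /gauss /normal_fun subr0.
by congr (_ * expR _); rewrite expr1n mulNr.
Qed.

Let peak0 : 0 < normal_peak (1 : R).
Proof. by rewrite normal_peak_gt0// oner_neq0. Qed.

Lemma gauss_ge0 x : 0 <= gauss x.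
Proof. by rewrite mulr_ge0 ?expR_ge0 ?ltW. Qed.

Lemma is_derive_gauss (x : R) : is_derive x 1 gauss (- x * gauss x).
Proof.
have h2 : is_derive x 1 (fun y : R => - 2^-1 * y ^+ 2) (- x).
  by apply: is_derive_eq (is_derive_monomial (- 2^-1) 2 x) _; rewrite /= expr1 -mulr_natr; field.
have := is_deriveZ (normal_peak (1 : R)) (@is_derive1_comp R expR (fun y => - 2^-1 * y ^+ 2) x _ _ (is_derive_expR _) h2).
have -> : normal_peak 1 \*: (expR \o (fun y : R => - 2^-1 * y ^+ 2)) = gauss.
  by apply/funext => y; rewrite /gauss /GRing.scale/=; congr (_ * expR _); field.
move=> h; apply: is_derive_eq h _; rewrite /gauss /GRing.scale/= mulrA [RHS]mulrC; congr (_ * expR _ * _).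
by field.
Qed.

Lemma continuous_gauss : continuous gauss.
Proof. exact: is_derive_continuous is_derive_gauss. Qed.

Lemma integrable_gauss : mu.-integrable setT (EFin \o gauss).
Proof. by rewrite -normal_pdf01; exact: integrable_normal_pdf. Qed.

Lemma integral_gauss : (\int[mu]_x (gauss x)%:E = 1)%E.
Proof. by rewrite -normal_pdf01 integral_normal_pdf. Qed.

Lemma integrable_gauss_bounded (f : R -> R) (C : R) : continuous f -> (forall x, `|f x| <= C) ->
  mu.-integrable setT (EFin \o (fun x => f x * gauss x)).
Proof.
move=> cf fC; have intC : mu.-integrable setT (EFin \o (fun x => C * gauss x)).
  exact: (integrableZl measurableT C integrable_gauss).
apply: le_integrable intC => //.
  apply/measurable_EFinP; apply: continuous_measurable_fun => x.
  by apply: cvgM; [exact: cf|exact: continuous_gauss].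
move=> x _; have g0 := gauss_ge0 x.
rewrite /= lee_fin normrM !(ger0_norm g0) normrM (ger0_norm g0) ler_wpM2r//.
exact: le_trans (fC x) (ler_norm C).
Qed.

(** Since [|x| <= 1 + x ^+ 2 / 4 <= expR (x ^+ 2 / 4)], a multiple of the normal density of variance
    2 dominates. *)
Lemma integrable_absM_gauss : mu.-integrable setT (EFin \o (fun x => `|x| * gauss x)).
Proof.
pose s : R := Num.sqrt 2.
have s0 : s != 0 by rewrite gt_eqF// sqrtr_gt0.
pose C : R := normal_peak 1 / normal_peak s.
have ps : 0 < normal_peak s by rewrite normal_peak_gt0.
have int2 : mu.-integrable setT (EFin \o (fun x => C * normal_pdf 0 s x)).
  have := integrableZl measurableT C (integrable_normal_pdf (0 : R) s).
  exact.
apply: le_integrable int2 => //.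
  apply/measurable_EFinP; apply: continuous_measurable_fun => x.
  by apply: cvgM; [exact: norm_continuous|exact: continuous_gauss].
move=> x _; rewrite /= lee_fin normrM normr_id [`|gauss x|]ger0_norm ?gauss_ge0//.
have -> : C * normal_pdf 0 s x = normal_peak 1 * expR (- (x ^+ 2 / 4)).
  rewrite normal_pdfE// /normal_fun subr0 mulrA divfK ?gt_eqF//; congr (_ * expR _).
  by rewrite sqr_sqrtr// -mulr_natr; field.
rewrite [leRHS]ger0_norm; last by rewrite mulr_ge0 ?expR_ge0 ?ltW.
rewrite /gauss mulrCA ler_pM2l//.
have -> : - (x ^+ 2 / 2) = - (x ^+ 2 / 4) + - (x ^+ 2 / 4) by field.
rewrite expRD mulrA ler_piMl ?expR_ge0//.
rewrite expRN ler_pdivrMr ?expR_gt0// mul1r; apply: le_trans (expR_ge1Dx _).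
have := real_normK (num_real x); have := sqr_ge0 (`|x| - 2); nra.
Qed.

Lemma is_derive_phase (l c x : R) (f df : R -> R) : (forall y : R, is_derive y 1 f (df y)) ->
  is_derive x 1 (fun y : R => f (l * y + c)) (l * df (l * x + c)).
Proof.
move=> fd; have hl : is_derive x 1 (fun y : R => l * y + c) l.
  have := is_deriveD (is_derive_monomial l 1 x) (is_derive_cst c x 1).
  by rewrite /= addr0 mulr1n expr0 mulr1.
by have := @is_derive1_comp R f (fun y => l * y + c) x _ _ (fd _) hl; rewrite mulrC.
Qed.

Lemma continuous_sin_phase (l c : R) : continuous (fun y : R => sin (l * y + c)).
Proof. by apply: is_derive_continuous => y; exact: (is_derive_phase l c y (@is_derive_sin R)). Qed.

Lemma continuous_cos_phase (l c : R) : continuous (fun y : R => cos (l * y + c)).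
Proof. by apply: is_derive_continuous => y; exact: (is_derive_phase l c y (@is_derive_cos R)). Qed.

Lemma integrable_sin_gauss (l c : R) :
  mu.-integrable setT (EFin \o (fun x => x * sin (l * x + c) * gauss x)).
Proof.
apply: le_integrable integrable_absM_gauss => //.
  apply/measurable_EFinP; apply: continuous_measurable_fun => x.
  by apply: cvgM; [apply: cvgM => //; exact: continuous_sin_phase|exact: continuous_gauss].
move=> x _; rewrite /= lee_fin !normrM normr_id -mulrA ler_wpM2l//.
by rewrite ler_piMl// ler_norml sin_geN1 sin_le1.
Qed.

(** The difference of the integrands is the derivative of [sin (l * x + c) * gauss x]. It is
    integrated over growing segments: dominated convergence gives the integral, and the boundary
    terms tend to 0. *)
Lemma gauss_by_parts (l c : R) :
  \int[mu]_x (x * sin (l * x + c) * gauss x) = l * \int[mu]_x (cos (l * x + c) * gauss x).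
Proof.
pose F (x : R) : R := sin (l * x + c) * gauss x.
pose f (x : R) : R := l * (cos (l * x + c) * gauss x) - x * sin (l * x + c) * gauss x.
have Fd (x : R) : is_derive x 1 F (f x).
  have := is_deriveM (@is_derive_phase l c x _ _ (@is_derive_sin R)) (is_derive_gauss x).
  move=> h; apply: is_derive_eq h _; rewrite /f /GRing.scale/=; ring.
have csin : continuous (fun y : R => sin (l * y + c)).
  by apply: is_derive_continuous => y; exact: (is_derive_phase l c y (@is_derive_sin R)).
have ccos : continuous (fun y : R => cos (l * y + c)).
  by apply: is_derive_continuous => y; exact: (is_derive_phase l c y (@is_derive_cos R)).
have int1 : mu.-integrable setT (EFin \o (fun x => cos (l * x + c) * gauss x)).
  by apply: (@integrable_gauss_bounded _ 1) => // x; rewrite ler_norml cos_geN1 cos_le1.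
have int2 := integrable_sin_gauss l c.
have int1' : mu.-integrable setT (EFin \o (fun x => l * (cos (l * x + c) * gauss x))).
  exact: (integrableZl measurableT l int1).
have intf : mu.-integrable setT (EFin \o f) by exact: (integrableB measurableT int1' int2).
have cf : continuous f.
  move=> x; apply: cvgB; apply: cvgM.
  - exact: cvg_cst.
  - by apply: cvgM; [exact: ccos|exact: continuous_gauss].
  - by apply: cvgM => //; exact: csin.
  - exact: continuous_gauss.
suff int0 : \int[mu]_x f x = 0.
  apply/eqP; rewrite -RintegralZl// eq_sym -subr_eq0 -RintegralB//; exact/eqP.
pose b (N : nat) : R := N.+1%:R.
have b_gt0 N : 0 < b N by exact: ltr0Sn.
have ftc (N : nat) : (\int[mu]_(x in `[(- b N)%R, b N]) (f x)%:E = (F (b N) - F (- b N))%R%:E)%E.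
  rewrite (@continuous_FTC2 _ f F)//.
  - by have := b_gt0 N; lra.
  - exact: continuous_subspaceT.
  - have cF := is_derive_continuous Fd.
    split; [by move=> x _; case: (Fd x)|apply: cvg_at_right_filter; exact: cF|apply: cvg_at_left_filter; exact: cF].
  - by move=> x _; rewrite derive1E; case: (Fd x).
have mf : measurable_fun setT (EFin \o f) by exact: (measurable_int mu).
have [|||||_ _ H] := @dominated_convergence _ _ R mu setT measurableT
   (fun N => (EFin \o f) \_ `[- b N, b N]) (EFin \o f) (fun x => `|(f x)%:E|)%E.
- by move=> N; apply/measurable_restrict => //; exact: measurable_funTS.
- exact: mf.
- apply: aeW => x _; apply: cvg_near_cst.
  near=> N; rewrite patchE ifT// inE/= in_itv/= -ler_norml.
  have /ltW h : `|x| < (Num.trunc `|x|).+1%:R by exact: truncnS_gt.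
  apply: le_trans h _; rewrite /b ler_nat ltnS.
  by near: N; exact: nbhs_infty_ge.
- exact: integrable_abse.
- apply: aeW => x N _; rewrite patchE; case: ifPn => // _.
  by have -> : (point : \bar R) = 0%E by []; rewrite abse0 abse_ge0.
have {}H : (F (b N) - F (- b N))%:E @[N --> \oo] --> (\int[mu]_x (EFin \o f) x)%E.
  apply: cvg_trans H; apply: near_eq_cvg; near=> N.
  by rewrite -ftc [RHS]integral_mkcond.
have Z : F (b N) - F (- b N) @[N --> \oo] --> (0 : R).
  have hc : 4 * normal_peak 1 * harmonic N @[N --> \oo] --> (0 : R).
    by rewrite -(mulr0 (4 * normal_peak 1)); apply: cvgM; [exact: cvg_cst|exact: cvg_harmonic].
  have bound N : `|F (b N) - F (- b N)| <= 4 * normal_peak 1 * harmonic N.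
    have Fg x : `|F x| <= gauss x.
      rewrite /F normrM (ger0_norm (gauss_ge0 x)) ler_piMl ?gauss_ge0//.
      by rewrite ler_norml sin_geN1 sin_le1.
    apply: le_trans (ler_normB _ _) _; apply: le_trans (lerD (Fg _) (Fg _)) _.
    (* Here [harmonic N] is the inverse of [b N], and [expR (b N ^+ 2 / 2) >= 1 + b N ^+ 2 / 2 >= b
       N / 2]. *)
    have hE : expR (- (b N ^+ 2 / 2)) <= 2 * harmonic N.
      have bN := b_gt0 N; rewrite expRN (_ : 2 * harmonic N = (b N / 2)^-1); last first.
        by rewrite invf_div.
      rewrite lef_pV2 ?posrE ?expR_gt0 ?divr_gt0//.
      have := expR_ge1Dx (b N ^+ 2 / 2); have := sqr_ge0 (b N - 1); nra.
    rewrite /gauss sqrrN; move: hE peak0; move: (expR _) (harmonic N) (normal_peak 1) => u h K; nra.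
  apply: (@squeeze_cvgr _ _ _ _ (fun N => - (4 * normal_peak 1 * harmonic N))
      (fun N => 4 * normal_peak 1 * harmonic N)) => //.
    by near=> N; rewrite -ler_norml.
  by rewrite -oppr0; exact: cvgN.
have : (F (b N) - F (- b N))%:E @[N --> \oo] --> 0%:E by apply: cvg_EFin => //; near=> N.
move=> /(cvg_unique _ H) H0; rewrite /Rintegral.
by rewrite [X in fine X]H0.
Unshelve. all: by end_near.
Qed.

Lemma is_derive_gauss_cf (c a : R) :
  is_derive a 1 (fun l : R => \int[mu]_x (cos (l * x + c) * gauss x))
    (- a * \int[mu]_x (cos (a * x + c) * gauss x)).
Proof.
pose f (l x : R) : R := cos (l * x + c) * gauss x.
have fd (x l : R) : is_derive l 1 (f^~ x) (- (x * sin (l * x + c) * gauss x)).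
  have -> : f^~ x = gauss x \*: (fun l : R => cos (x * l + c)).
    by apply/funext => m; rewrite /f mulrC [m * x]mulrC.
  have := is_deriveZ (gauss x) (is_derive_phase x c l (@is_derive_cos R)).
  by move=> h; apply: is_derive_eq h _; rewrite /GRing.scale/= [x * l]mulrC; ring.
have Ia : `]a - 1, a + 1[%classic a by rewrite /= in_itv/=; apply/andP; split; lra.
have intf l : `]a - 1, a + 1[%classic l -> mu.-integrable setT (EFin \o f l).
  move=> _; apply: (@integrable_gauss_bounded _ 1) => [|x]; last by rewrite ler_norml cos_geN1 cos_le1.
  by apply: is_derive_continuous => y; exact: (is_derive_phase l c y (@is_derive_cos R)).
have derf (l x : R) : `]a - 1, a + 1[%classic l -> setT x -> derivable (f^~ x) l 1.
  by move=> _ _; case: (fd x l).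
have p1 l x : partial1of2 f l x = - (x * sin (l * x + c) * gauss x).
  by rewrite partial1of2E; case: (fd x l).
have G0 (x : R) : 0 <= `|x| * gauss x by rewrite mulr_ge0 ?gauss_ge0.
have Gub (l x : R) : `]a - 1, a + 1[%classic l -> setT x -> `|partial1of2 f l x| <= `|x| * gauss x.
  move=> _ _; rewrite p1 normrN 2!normrM (ger0_norm (gauss_ge0 x)) -mulrA ler_wpM2l//.
  by rewrite ler_piMl ?gauss_ge0// ler_norml sin_geN1 sin_le1.
have dv := derivable_under_integral measurableT Ia intf derf G0 integrable_absM_gauss Gub.
have e1 := differentiation_under_integral measurableT Ia intf derf G0 integrable_absM_gauss Gub.
apply: DeriveDef; first exact: dv.
rewrite -derive1E e1.
transitivity (\int[mu]_x (-1 * (x * sin (a * x + c) * gauss x))).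
  by apply: eq_Rintegral => x _; rewrite p1 mulN1r.
by rewrite RintegralZl// ?gauss_by_parts ?mulN1r ?mulNr//; exact: integrable_sin_gauss.
Qed.

(* Integration by parts shows that [phi' l = - l * phi l]. *)
Lemma gauss_cf (l c : R) : \int[mu]_x (cos (l * x + c) * gauss x) = cos c * expR (- (l ^+ 2 / 2)).
Proof.
pose phi (l : R) : R := \int[mu]_x (cos (l * x + c) * gauss x).
pose psi (l : R) : R := phi l * expR (2^-1 * l ^+ 2).
have d0 (a : R) : is_derive a 1 psi 0.
  have h2 : is_derive a 1 (fun y : R => 2^-1 * y ^+ 2) a.
    by apply: is_derive_eq (is_derive_monomial 2^-1 2 a) _; rewrite /= expr1 -mulr_natr; field.
  have h3 := @is_derive1_comp R expR (fun y => 2^-1 * y ^+ 2) a _ _ (is_derive_expR _) h2.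
  have := is_deriveM (is_derive_gauss_cf c a) h3.
  by move=> h; apply: is_derive_eq h _; rewrite /GRing.scale/= -/(phi a); ring.
have := is_derive_0_is_cst l 0 d0; rewrite /psi expr0n/= mulr0 expR0 mulr1.
have -> : phi 0 = cos c.
  rewrite /phi; under eq_Rintegral do rewrite mul0r add0r.
  rewrite RintegralZl//; last exact: integrable_gauss.
  by rewrite /Rintegral integral_gauss mulr1.
by move=> <-; rewrite -mulrA -expRD (_ : _ + _ = 0) ?expR0 ?mulr1//; field.
Qed.

(** The Radon-Nikodym derivative of the normal law agrees almost everywhere with [gauss], since both
    have the same integral over every measurable set. *)
Lemma integral_normal01 (f : R -> R) : (normal_prob (0 : R) 1).-integrable setT (EFin \o f) ->
  (\int[normal_prob (0 : R) 1]_x (f x)%:E = \int[mu]_x (f x * gauss x)%:E)%E.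
Proof.
move=> intf; have dom := normal_prob_dominates (0 : R) 1.
have mf : measurable_fun setT (EFin \o f) by exact: (measurable_int _ intf).
have mg : measurable_fun setT (EFin \o gauss) by exact: (measurable_int _ integrable_gauss).
under [RHS]eq_integral do rewrite EFinM.
rewrite -(Radon_Nikodym_change_of_variables dom measurableT intf).
have H : ae_eq mu setT (Radon_Nikodym (charge_of_finite_measure (normal_prob (0 : R) 1)) mu)
    (EFin \o gauss).
  apply: integral_ae_eq => //; first by apply: Radon_Nikodym_integrable; exact: dom.
  move=> E _ mE; transitivity (charge_of_finite_measure (normal_prob (0 : R) 1) E).
    by apply/esym/Radon_Nikodym_integral => //; exact: dom.
  by rewrite /= /normal_prob normal_pdf01.
apply: ae_eq_integral => //; [exact: emeasurable_funM|exact: emeasurable_funM|].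
by apply: filterS H => x /= h xD; rewrite h.
Qed.

End GaussianIntegrals.

(** * Lévy's continuity theorem *)

Section BinomialAverage.
Variable R : realType.
Implicit Types (F G : nat -> R) (u : R).

(* The expectation of [F] at a binomial variable of parameters [n] and [u]. *)
Fixpoint binom_avg (n : nat) F u : R :=
  if n is m.+1 then u * binom_avg m (F \o S) u + (1 - u) * binom_avg m F u else F 0%N.

Lemma binom_avgD n F G u : binom_avg n (fun k => F k + G k) u = binom_avg n F u + binom_avg n G u.
Proof.
elim: n F G => [//|n ih] F G /=.
rewrite (_ : _ \o S = (fun k => (F \o S) k + (G \o S) k))// !ih; ring.
Qed.

Lemma binom_avgZ n c F u : binom_avg n (fun k => c * F k) u = c * binom_avg n F u.
Proof.
elim: n F => [//|n ih] F /=.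
rewrite (_ : _ \o S = (fun k => c * (F \o S) k))// !ih; ring.
Qed.

Lemma binom_avg_cst n c u : binom_avg n (fun=> c) u = c.
Proof. by elim: n => [//|n ih] /=; rewrite (_ : _ \o S = fun=> c)// ih; ring. Qed.

Lemma le_binom_avg n F G u : 0 <= u <= 1 -> (forall k, F k <= G k) ->
  binom_avg n F u <= binom_avg n G u.
Proof.
move=> /andP[u0 u1]; elim: n F G => [|n ih] F G FG /=; first exact: FG.
by apply: lerD; apply: ler_wpM2l; rewrite ?subr_ge0//; apply: ih => k; exact: FG.
Qed.

Lemma ler_norm_binom_avg n F u C : 0 <= u <= 1 -> (forall k, `|F k| <= C) ->
  `|binom_avg n F u| <= C.
Proof.
move=> u01 FC; rewrite ler_norml -[X in X <= _ <= _](binom_avg_cst n (- C) u).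
rewrite -[X in _ <= _ <= X](binom_avg_cst n C u).
by rewrite !le_binom_avg// => k; have := FC k; rewrite ler_norml => /andP[].
Qed.

Lemma binom_avg_id n u : binom_avg n (fun k => k%:R) u = n%:R * u.
Proof.
elim: n => [|n ih] /=; first by rewrite mul0r.
rewrite (_ : _ \o S = fun k => k%:R + 1); last by apply/funext => k /=; rewrite -natr1.
rewrite binom_avgD binom_avg_cst ih -natr1; ring.
Qed.

Lemma binom_avg_sqr n u :
  binom_avg n (fun k => k%:R ^+ 2) u = n%:R * u * (1 - u) + (n%:R * u) ^+ 2.
Proof.
elim: n => [|n ih] /=; first by rewrite !mul0r expr0n/= add0r.
rewrite (_ : _ \o S = fun k => k%:R ^+ 2 + (2 * k%:R + 1)); last first.
  by apply/funext => k /=; rewrite -natr1; ring.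
rewrite !binom_avgD binom_avgZ binom_avg_cst binom_avg_id ih -natr1; ring.
Qed.

Lemma binom_avg_variance n u : (0 < n)%N ->
  binom_avg n (fun k => (k%:R / n%:R - u) ^+ 2) u = u * (1 - u) / n%:R.
Proof.
move=> n0; have nn : (n%:R : R) != 0 by rewrite pnatr_eq0 -lt0n.
rewrite (_ : (fun k => _) = fun k => n%:R ^- 2 * k%:R ^+ 2 + (- (2 * u / n%:R) * k%:R + u ^+ 2)); last first.
  by apply/funext => k; field.
by rewrite !binom_avgD !binom_avgZ binom_avg_cst binom_avg_id binom_avg_sqr; field.
Qed.

(** Bernstein's argument: the quadratic penalty [2 * C / d ^+ 2 * (x - u) ^+ 2] covers the points at
    distance at least [d], and its binomial average is controlled by the variance and
    [u * (1 - u) <= 1 / 4]. *)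
Lemma binom_avg_approx (h : R -> R) (C eps d : R) n u : 0 < d -> (0 < n)%N -> 0 <= u <= 1 ->
  (forall x, `|h x| <= C) -> (forall x y, `|x - y| < d -> `|h x - h y| <= eps) ->
  `|binom_avg n (fun k => h (k%:R / n%:R)) u - h u| <= eps + C / (2 * d ^+ 2 * n%:R).
Proof.
move=> d0 n0 u01 hC hd.
have nn : (n%:R : R) != 0 by rewrite pnatr_eq0 -lt0n.
have n0' : 0 < (n%:R : R) by rewrite ltr0n.
have C0 : 0 <= C by apply: le_trans (hC 0).
have e0 : 0 <= eps by apply: le_trans (hd 0 0 _); rewrite ?subrr ?normr0.
have K0 : 0 <= 2 * C / d ^+ 2 by apply: divr_ge0 (sqr_ge0 d); exact: mulr_ge0.
have key x : `|h x - h u| <= eps + 2 * C / d ^+ 2 * (x - u) ^+ 2.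
  have [lt|ge] := ltP `|x - u| d.
    by apply: le_trans (hd _ _ lt) _; rewrite lerDl mulr_ge0 ?sqr_ge0.
  apply: le_trans (ler_normB _ _) _; apply: le_trans (lerD (hC _) (hC _)) _.
  apply: le_trans (_ : 2 * C / d ^+ 2 * d ^+ 2 <= _).
    by rewrite divfK ?sqrf_eq0 ?gt_eqF//; lra.
  rewrite ler_wpDl// ler_wpM2l//.
  by rewrite -[(x - u) ^+ 2]real_normK ?num_real// ler_pXn2r// nnegrE// ltW.
have -> : binom_avg n (fun k => h (k%:R / n%:R)) u - h u = binom_avg n (fun k => h (k%:R / n%:R) - h u) u.
  by rewrite binom_avgD binom_avg_cst.
have up : binom_avg n (fun k => eps + 2 * C / d ^+ 2 * (k%:R / n%:R - u) ^+ 2) u <= eps + C / (2 * d ^+ 2 * n%:R).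
  rewrite binom_avgD binom_avg_cst binom_avgZ binom_avg_variance// lerD2l.
  have dn : d != 0 by rewrite gt_eqF.
  have -> : C / (2 * d ^+ 2 * n%:R) = 2 * C / d ^+ 2 / n%:R * 4^-1 by field; rewrite nn dn.
  have -> : 2 * C / d ^+ 2 * (u * (1 - u) / n%:R) = 2 * C / d ^+ 2 / n%:R * (u * (1 - u)).
    by field; rewrite nn dn.
  apply: ler_wpM2l; first exact: divr_ge0 K0 (ltW n0').
  by have := sqr_ge0 (u - 2^-1); nra.
rewrite ler_norml; apply/andP; split.
  rewrite lerNl -mulN1r -binom_avgZ; apply: le_trans up; apply: le_binom_avg => // k.
  by rewrite mulN1r; apply: le_trans (key _); rewrite -normrN ler_norm.
by apply: le_trans up; apply: le_binom_avg => // k; apply: le_trans (key _); exact: ler_norm.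
Qed.

End BinomialAverage.

Section TrigApprox.
Variable R : realType.

(** The linear span of cosines with arbitrary frequency and phase: convergence of characteristic
    functions passes to it by induction. *)
Inductive trig_poly : (R -> R) -> Prop :=
| TrigCos l c : trig_poly (fun x => cos (l * x + c))
| TrigAdd f g : trig_poly f -> trig_poly g -> trig_poly (fun x => f x + g x)
| TrigScale k f : trig_poly f -> trig_poly (fun x => k * f x).

Lemma trig_poly_cst c : trig_poly (fun=> c).
Proof.
rewrite (_ : (fun=> c) = fun x => c * cos (0 * x + 0)); first exact/TrigScale/TrigCos.
by apply/funext => x; rewrite mul0r addr0 cos0 mulr1.
Qed.

Lemma trig_poly_sinM w f : trig_poly f -> trig_poly (fun x => sin (w * x) * f x).
Proof.
elim=> [l c|{}f g _ hf _ hg|k {}f _ hf].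
- rewrite (_ : (fun x => _) = fun x =>
    2^-1 * cos ((l + w) * x + (c - pi / 2)) + - 2^-1 * cos ((l - w) * x + (c - pi / 2))).
    by apply: TrigAdd; apply: TrigScale; exact: TrigCos.
  apply/funext => x; rewrite !addrA !cosBpihalf.
  have -> : (l + w) * x + c = (l * x + c) + w * x by ring.
  have -> : (l - w) * x + c = (l * x + c) - w * x by ring.
  by rewrite sinD sinB; field.
- rewrite (_ : (fun x => _) = fun x => sin (w * x) * f x + sin (w * x) * g x); first exact: TrigAdd.
  by apply/funext => x; rewrite mulrDr.
- rewrite (_ : (fun x => _) = fun x => k * (sin (w * x) * f x)); first exact: TrigScale.
  by apply/funext => x; rewrite mulrCA.
Qed.

(** The recursion of [binom_avg] only multiplies by [(1 + sin (w * x)) / 2] and its complement, so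
    closure under multiplication by the sine is enough. *)
Lemma trig_poly_binom_avg w n (F : nat -> R) :
  trig_poly (fun x => binom_avg n F ((1 + sin (w * x)) / 2)).
Proof.
elim: n F => [|n ih] F /=; first exact: trig_poly_cst.
pose f (x : R) := binom_avg n (F \o S) ((1 + sin (w * x)) / 2).
pose g (x : R) := binom_avg n F ((1 + sin (w * x)) / 2).
have hf : trig_poly f by exact: ih.
have hg : trig_poly g by exact: ih.
rewrite (_ : (fun x => _) = fun x => (2^-1 * f x + 2^-1 * g x) +
   (2^-1 * (sin (w * x) * f x) + - 2^-1 * (sin (w * x) * g x))).
  by apply: TrigAdd; apply: TrigAdd; apply: TrigScale => //; exact: trig_poly_sinM.
by apply/funext => x; rewrite /f /g; field.
Qed.

(** Heine's theorem in the near-covering form of compactness; [y] may leave the segment. *)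
Lemma segment_unif_continuous (f : R -> R) (L eps : R) : continuous f -> 0 < eps ->
  exists2 d, 0 < d & forall x y, `|x| <= L -> `|x - y| < d -> `|f x - f y| <= eps.
Proof.
move=> cf e0.
pose P (d x : R) := forall y, `|x - y| < d -> `|f x - f y| <= eps.
have := (compact_near_coveringP _).1 (@segment_compact R (- L) L) R (0^'+) P.
move=> /(_ _ _)[].
  move=> x _; have /cvgrPdist_lt/(_ (eps / 2)) := cf x.
  move=> /(_ _)/nbhs_ballP[]; first by rewrite divr_gt0.
  move=> /= eta eta0 hb.
  exists (ball x (eta / 2), [set d : R | d < eta / 2]).
    split => /=; first by apply: nbhsx_ballx; rewrite divr_gt0.
    by apply: nbhs_right_lt; rewrite divr_gt0.
  move=> [x' d] /= [hx' hd] y hy.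
  have h1 : `|f x - f x'| < eps / 2.
    apply: hb; apply: le_ball hx'; rewrite ler_pdivrMr//; lra.
  have h2 : `|f x - f y| < eps / 2.
    apply: hb; rewrite /ball/= (_ : x - y = (x - x') + (x' - y)); last by ring.
    by move: hx'; rewrite /ball/= => hx'; have := ler_normD (x - x') (x' - y); lra.
  rewrite (_ : f x' - f y = (f x - f y) - (f x - f x')); last by ring.
  by apply: le_trans (ler_normB _ _) _; lra.
move=> d /= d0 hd; exists (d / 2); first by rewrite divr_gt0.
move=> x y xL xy; apply: (hd (d / 2) _ _ x) => //=.
- by rewrite sub0r normrN gtr0_norm ?divr_gt0// ltr_pdivrMr//; lra.
- by rewrite divr_gt0.
- by rewrite in_itv/= -ler_norml.
Qed.

Definition clamp (s v : R) : R := Num.max (- s) (Num.min s v).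

Lemma clamp_lip s v v' : `|clamp s v - clamp s v'| <= `|v - v'|.
Proof.
apply: le_trans (_ : `|Num.min s v - Num.min s v'| <= _).
  rewrite /clamp; move: (Num.min s v) (Num.min s v') => x y.
  have h1 := ler_norm (x - y); have := ler_norm (y - x); rewrite distrC => h2.
  by rewrite ler_norml; case: (leP (- s) x) => ?; case: (leP (- s) y) => ?; apply/andP; split; lra.
have h1 := ler_norm (v - v'); have := ler_norm (v' - v); rewrite distrC => h2.
by rewrite ler_norml; case: (leP s v) => ?; case: (leP s v') => ?; apply/andP; split; lra.
Qed.

(* [h ((1 + sin (w * x)) / 2) = f x] for [`|x| <= L], and [h] is replaced by its
   Bernstein polynomial. *)
Lemma trig_approx (f : R -> R) (C L eps : R) : continuous f -> (forall x, `|f x| <= C) ->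
  0 < L -> 0 < eps ->
  exists T, [/\ trig_poly T, forall x, `|T x| <= C & forall x, `|x| <= L -> `|f x - T x| <= eps].
Proof.
move=> cf fC L0 e0.
have [d d0 hd] := segment_unif_continuous L cf (divr_gt0 e0 (ltr0n _ 2 : 0 < 2)).
have C0 : 0 <= C by apply: le_trans (fC 0).
have pi2 : 1 / 2 <= pi / 2 :> R by have := pi_ge2 R; lra.
pose s : R := sin (1 / 2).
have cosb (z : R) : `|z| <= 1 / 2 -> 1 / 2 <= cos z.
  move=> z1; have := cos_taylor3 z.
  have : `|z| ^+ 3 <= (1 / 2) ^+ 3 by rewrite ler_pXn2r ?nnegrE.
  have : z ^+ 2 <= (1 / 2) ^+ 2 by rewrite -real_normK ?num_real// ler_pXn2r ?nnegrE.
  rewrite ler_norml => h1 h2 /andP[h3 h4]; lra.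
(* The cosine is at least [1 / 2] there, so the inverse of the sine is 2-Lipschitz on the clamped
   values. *)
have lip (a b : R) : `|a| <= 1 / 2 -> `|b| <= 1 / 2 -> `|a - b| <= 2 * `|sin a - sin b|.
  wlog ab : a b / b <= a => [hw|] ha hb.
    have [|/ltW] := leP b a; first by move=> /hw; apply.
    by move=> /hw; rewrite distrC [`|sin a - _|]distrC; apply.
  have [|z] := @MVT_segment R sin cos b a ab (fun z _ => is_derive_sin z).
    exact/continuous_subspaceT/continuous_sin.
  rewrite in_itv/= => /andP[bz za] ->; rewrite normrM.
  have cz : 1 / 2 <= cos z.
    by apply: cosb; move: ha hb; rewrite !ler_norml => /andP[? ?] /andP[? ?]; apply/andP; split; lra.
  rewrite (ger0_norm (_ : 0 <= cos z)); last by lra.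
  by have := normr_ge0 (a - b); nra.
have s0 : 0 <= s by apply: sin_ge0_pi; apply/andP; split; have := pi_ge2 R; lra.
have s1 : s <= 1 by exact: sin_le1.
have clampP v : - s <= clamp s v <= s.
  by rewrite /clamp le_max lexx /= ge_max ge_min lexx /= andbT; lra.
pose g (v : R) := asin (clamp s v).
have gP v : `|g v| <= 1 / 2 /\ sin (g v) = clamp s v.
  have /andP[c1 c2] := clampP v; have c11 : -1 <= clamp s v <= 1 by apply/andP; split; lra.
  have [/andP[a1 a2] a3] := asin_def c11; split=> //; rewrite ler_norml.
  have mono : {in `[- (pi / 2), pi / 2] &, {mono (@sin R) : x y / x < y}} by exact: ltr_sin.
  apply/andP; split; rewrite leNgt; apply/negP => lt.
    have : sin (g v) < sin (- (1 / 2)) by rewrite mono ?in_itv/= ?a1 ?a2//; apply/andP; split; lra.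
    by rewrite sinN a3 -/s; lra.
  have : sin (1 / 2) < sin (g v) by rewrite mono ?in_itv/= ?a1 ?a2//; apply/andP; split; lra.
  by rewrite a3 -/s; lra.
pose w : R := 1 / (2 * L).
have w0 : 0 < w by rewrite divr_gt0 ?mulr_gt0.
have wL : w * L = 1 / 2 by rewrite /w; field; rewrite gt_eqF.
pose h (u : R) := f (g (2 * u - 1) / w).
have gw v : `|g v / w| <= L.
  have [gv _] := gP v; rewrite normrM normfV (gtr0_norm w0) ler_pdivrMr//.
  by rewrite mulrC wL.
have hC u : `|h u| <= C by exact: fC.
(* The argument of [f] in [h u] is Lipschitz in [u] with constant [4 / w]: 2 from the affine map, 2
   from the arcsine, and the division by [w]. *)
pose dd : R := d * w / 4.
have dd0 : 0 < dd by apply: divr_gt0; [exact: mulr_gt0|rewrite ltr0n].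
have hdd x y : `|x - y| < dd -> `|h x - h y| <= eps / 2.
  move=> xy; apply: hd; first exact: gw.
  rewrite -mulrBl normrM normfV (gtr0_norm w0) ltr_pdivrMr//.
  have [g1 e1] := gP (2 * x - 1); have [g2 e2] := gP (2 * y - 1).
  apply: le_lt_trans (lip _ _ g1 g2) _; rewrite e1 e2.
  have := clamp_lip s (2 * x - 1) (2 * y - 1).
  rewrite (_ : 2 * x - 1 - _ = 2 * (x - y)); last by ring.
  by rewrite normrM ger0_norm//; rewrite /dd in xy; lra.
have hf x : `|x| <= L -> h ((1 + sin (w * x)) / 2) = f x.
  move=> xL; rewrite /h (_ : 2 * _ - 1 = sin (w * x)); last by field.
  have wx : `|w * x| <= 1 / 2.
    rewrite normrM (gtr0_norm w0); apply: le_trans (_ : w * L <= _); first by rewrite ler_pM2l.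
    by rewrite wL.
  have sx : - s <= sin (w * x) <= s.
    have mono : {in `[- (pi / 2), pi / 2] &, {mono (@sin R) : x y / x <= y}}.
      by apply: le_mono_in => a b ai bi ab; rewrite ltr_sin.
    move: wx; rewrite ler_norml => /andP[wx1 wx2].
    rewrite /s -sinN !mono ?in_itv/= ?wx1//; apply/andP; split; move: pi2 wx1 wx2; clear; lra.
  have cx : clamp s (sin (w * x)) = sin (w * x).
    by move: sx => /andP[? ?]; rewrite /clamp (min_idPr _)// (max_idPr _).
  have gx : g (sin (w * x)) = w * x.
    have [g1 e1] := gP (sin (w * x)); rewrite cx in e1.
    apply/eqP; rewrite -subr_eq0 -normr_le0; apply: le_trans (lip _ _ g1 wx) _.
    by rewrite e1 subrr normr0 mulr0.
  by rewrite gx mulrAC divff ?mul1r// gt_eqF.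
pose n := (Num.trunc (C / (2 * dd ^+ 2) / (eps / 2))).+1.
have u01 x : 0 <= (1 + sin (w * x)) / 2 <= 1.
  by have := sin_geN1 (w * x); have := sin_le1 (w * x) => *; apply/andP; split; lra.
exists (fun x => binom_avg n (fun k => h (k%:R / n%:R)) ((1 + sin (w * x)) / 2)); split.
- exact: trig_poly_binom_avg.
- by move=> x; apply: ler_norm_binom_avg => // k.
- move=> x xL; rewrite -(hf x xL) distrC.
  apply: le_trans (binom_avg_approx dd0 (ltn0Sn _) (u01 x) hC hdd) _.
  suff : C / (2 * dd ^+ 2 * n%:R) <= eps / 2 by rewrite -/n; lra.
  have p0 : 0 < 2 * dd ^+ 2 by rewrite mulr_gt0 ?exprn_gt0.
  rewrite invfM mulrA ler_pdivrMr ?ltr0Sn// -ler_pdivrMl ?divr_gt0// mulrC.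
  by apply/ltW; exact: truncnS_gt.
Qed.

End TrigApprox.

Section Levy.
Variable R : realType.
Local Notation mu := (@lebesgue_measure R).

Lemma trig_poly_integrable (T : R -> R) : trig_poly T ->
  mu.-integrable setT (EFin \o (fun x => T x * gauss x)).
Proof.
elim=> [l c|f g _ hf _ hg|k f _ hf].
- apply: (@integrable_gauss_bounded _ _ 1); first exact: continuous_cos_phase.
  by move=> x; rewrite ler_norml cos_geN1 cos_le1.
- rewrite (_ : (fun x => _) = (fun x => f x * gauss x + g x * gauss x)).
    exact: (integrableD measurableT hf hg).
  by apply/funext => x; rewrite mulrDl.
- rewrite (_ : (fun x => _) = (fun x => k * (f x * gauss x))).
    exact: (integrableZl measurableT k hf).
  by apply/funext => x; rewrite mulrA.
Qed.

Variables (J : Type) (F : set_system J).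
Context {FF : Filter F}.
Variables (Om : J -> finType) (S : forall j, Om j -> R).
Hypothesis Om0 : forall j, (0 < #|Om j|)%N.
Hypothesis cvg_cf : forall l c : R,
  avg (fun x : Om j => cos (l * S x + c)) @[j --> F] --> cos c * expR (- (l ^+ 2 / 2)).
Hypothesis tight : forall eta : R, 0 < eta -> exists L0 : R, forall L, L0 <= L ->
  \forall j \near F, avg (fun x : Om j => (L < `|S x|)%R%:R) <= eta.

Lemma cvg_trig_poly (T : R -> R) : trig_poly T ->
  avg (fun x : Om j => T (S x)) @[j --> F] --> \int[mu]_x (T x * gauss x).
Proof.
elim=> [l c|f g hf cf hg cg|k f hf cf].
- by rewrite gauss_cf; exact: cvg_cf.
- have -> : \int[mu]_x ((f x + g x) * gauss x) =
      \int[mu]_x (f x * gauss x) + \int[mu]_x (g x * gauss x).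
    rewrite -RintegralD//; [|exact: trig_poly_integrable|exact: trig_poly_integrable].
    by apply: eq_Rintegral => x _; rewrite mulrDl.
  by under eq_fun do rewrite avgD; exact: cvgD.
- have -> : \int[mu]_x (k * f x * gauss x) = k * \int[mu]_x (f x * gauss x).
    rewrite -RintegralZl//; last exact: trig_poly_integrable.
    by apply: eq_Rintegral => x _; rewrite mulrA.
  by under eq_fun do rewrite avgZ; apply: cvgM => //; exact: cvg_cst.
Qed.

(** A trigonometric polynomial [T] is close to [f] on [[-L, L]] and bounded by [C] everywhere.
    Outside, the error [2 * C] is absorbed by tightness for the variables and by Markov's inequality
    for the Gaussian. *)
Theorem levy_continuity (f : R -> R) (C : R) : continuous f -> (forall x, `|f x| <= C) ->
  avg (fun x : Om j => f (S x)) @[j --> F] --> \int[mu]_x (f x * gauss x).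
Proof.
move=> cf fC; apply/cvgrPdist_le => eps e0.
have C0 : 0 <= C by apply: le_trans (fC 0).
pose A := \int[mu]_x (`|x| * gauss x).
have A0 : 0 <= A by apply: Rintegral_ge0 => x _; rewrite mulr_ge0 ?gauss_ge0.
(* The level makes [2 * C] times the tail at most [eps / 8]; the 1 in the denominator handles
   [C = 0]. *)
have [L0 hL0] := tight (divr_gt0 e0 (ltr_pwDl ltr01 (mulr_ge0 (ler0n R 16) C0)) : 0 < eps / (1 + 16 * C)).
pose L : R := 1 + `|L0| + 16 * C * A / eps.
have q0 : 0 <= 16 * C * A / eps by rewrite divr_ge0 ?mulr_ge0// ltW.
have LL0 : L0 <= L by rewrite /L; have := ler_norm L0; lra.
have Lpos : 0 < L by rewrite /L; have := normr_ge0 L0; lra.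
have LA : 2 * C / L * A <= eps / 8.
  rewrite mulrAC ler_pdivrMr//.
  have : 16 * C * A / eps <= L by rewrite /L; have := normr_ge0 L0; lra.
  by rewrite ler_pdivrMr// => h; nra.
have [T [hT TC fT]] := trig_approx cf fC Lpos (divr_gt0 e0 (ltr0n R 8 : 0 < 8)).
have intf := integrable_gauss_bounded cf fC.
have intT := trig_poly_integrable hT.
have int1 : mu.-integrable setT (EFin \o (fun x => eps / 8 * gauss x)).
  exact: (integrableZl measurableT _ (@integrable_gauss R)).
have int2 : mu.-integrable setT (EFin \o (fun x => 2 * C / L * (`|x| * gauss x))).
  exact: (integrableZl measurableT _ (@integrable_absM_gauss R)).
have dfT x : `|f x - T x| <= 2 * C.
  by apply: le_trans (ler_normB _ _) _; have := fC x; have := TC x; lra.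
have h1 : `|\int[mu]_x (f x * gauss x) - \int[mu]_x (T x * gauss x)| <= eps / 4.
  rewrite -RintegralB//; apply: le_trans (le_normr_Rintegral _ _) _ => //.
    exact: (integrableB measurableT intf intT).
  apply: (@le_trans _ _ (\int[mu]_x (eps / 8 * gauss x + 2 * C / L * (`|x| * gauss x)))).
    apply: le_Rintegral => //.
    - exact: (integrable_norm (integrableB measurableT intf intT)).
    - exact: (integrableD measurableT int1 int2).
    move=> x _; rewrite -mulrBl normrM (ger0_norm (gauss_ge0 x)).
    rewrite (_ : _ + _ = (eps / 8 + 2 * C / L * `|x|) * gauss x); last by ring.
    rewrite ler_wpM2r ?gauss_ge0//.
    have [xL|xL] := leP `|x| L.
      apply: le_trans (fT x xL) _; rewrite lerDl mulr_ge0 ?divr_ge0 ?mulr_ge0//; exact: ltW.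
    apply: le_trans (dfT x) _; have : 2 * C <= 2 * C / L * `|x|.
      by rewrite mulrAC ler_pdivlMr// ler_wpM2l ?mulr_ge0// ltW.
    have := e0; lra.
  have e1 : \int[mu]_x (eps / 8 * gauss x) = eps / 8.
    have ig := @integrable_gauss R.
    by rewrite RintegralZl// /Rintegral integral_gauss mulr1.
  have e2 : \int[mu]_x (2 * C / L * (`|x| * gauss x)) = 2 * C / L * A.
    have ig := @integrable_absM_gauss R.
    by rewrite RintegralZl.
  by rewrite RintegralD// e1 e2; lra.
have h2 := cvg_trig_poly hT; move/cvgrPdist_le : h2 => /(_ (eps / 4)).
move=> /(_ (divr_gt0 e0 (ltr0n R 4 : 0 < 4))) h2.
near=> j.
have h3 : `|avg (fun x : Om j => f (S x)) - avg (fun x : Om j => T (S x))| <= eps / 4.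
  rewrite -avgB; apply: le_trans (ler_norm_avg _) _.
  apply: (@le_trans _ _ (avg (fun x : Om j => eps / 8 + 2 * C * (L < `|S x|)%R%:R))).
    apply: le_avg => x; have [xL|xL] := leP `|S x| L.
      by rewrite mulr0 addr0 fT.
    by rewrite mulr1; apply: le_trans (dfT _) _; rewrite lerDr divr_ge0// ltW.
  rewrite avgD (avgZ (2 * C)) avg_cst//.
  have : avg (fun x : Om j => (L < `|S x|)%R%:R) <= eps / (1 + 16 * C).
    by near: j; exact: hL0.
  by rewrite ler_pdivlMr; [move=> hh; nra|lra].
have h4 : `|\int[mu]_x (T x * gauss x) - avg (fun x : Om j => T (S x))| <= eps / 4.
  by near: j; exact: h2.
move: h1 h3 h4.
set a := \int[mu]_x (f x * gauss x); set b := \int[mu]_x (T x * gauss x).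
set c := avg _; set d := avg _ => h1 h3 h4.
rewrite (_ : a - c = (a - b) + (b - d) - (c - d)); last by ring.
apply: le_trans (ler_normB _ _) _; apply: le_trans (lerD (ler_normD _ _) (lexx _)) _; lra.
Unshelve. all: by end_near.
Qed.

End Levy.

(** * Averages over the units *)

Lemma real_complex_avg (R : realType) (X : finType) (f : X -> R) :
  (avg f)%:C%C = avg (fun x => (f x)%:C%C) :> R[i].
Proof.
by rewrite /avg rmorphM fmorphV rmorph_nat rmorph_sum.
Qed.

Section WordMoments.
Variables (R : realType) (p n : nat).
Hypotheses (pp : prime p) (n2 : (2 <= n)%N).
Local Notation q := (p ^ n)%N.
Local Notation A := ('Z_q).
Local Notation red := (@red p n).
Local Notation chi := (@chi R p n).
Variables (T : finType) (W : T * 'F_p -> R[i]) (j : nat).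
Hypothesis good : forall g : 'I_j -> T * 'F_p, \prod_i W (g i) != 0 ->
  \sum_i (g i).2 = 0 -> forall y, \sum_(i | (g i).1 == y) (g i).2 = 0.

Lemma chi_avg (h : 'F_p) : avg (fun a : A => chi (red a * h)) = (h == 0)%:R.
Proof.
rewrite /avg chi_sum// card_ord Zp_cast; last exact: q_gt1.
case: eqVneq => _; last by rewrite mulr0.
by rewrite mulVf// pnatr_eq0 -lt0n ltnW// q_gt1.
Qed.

Lemma chi_prod (X : finType) (P : pred X) (f : X -> 'F_p) :
  \prod_(i | P i) chi (f i) = chi (\sum_(i | P i) f i).
Proof. by symmetry; apply: (big_morph chi); [exact: chiD|exact: chi0]. Qed.

(** Expand both powers over words of letters [(y, h)]. At a common point a word averages to 1 or 0
    according to whether its [h] add up to 0; at independent points they must do so for each [y]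
    separately. The hypothesis [good] identifies the two conditions on the words of nonzero
    weight. *)
Lemma word_moments :
  avg (fun a : A => (\sum_k W k * chi (red a * k.2)) ^+ j) =
  avg (fun r : {ffun T -> A} => (\sum_k W k * chi (red (r k.1) * k.2)) ^+ j).
Proof.
have expand (f : T * 'F_p -> R[i]) : (\sum_k f k) ^+ j = \sum_(g : {ffun 'I_j -> T * 'F_p}) \prod_i f (g i).
  by rewrite -[in LHS](card_ord j) -prodr_const bigA_distr_bigA.
transitivity (\sum_(g : {ffun 'I_j -> T * 'F_p}) \prod_i W (g i) * (\sum_i (g i).2 == 0)%:R).
  under eq_avg do rewrite expand.
  rewrite avg_sum; apply: eq_bigr => g _; rewrite -chi_avg -avgZ; apply: eq_avg => a.
  by rewrite big_split/= chi_prod mulr_sumr.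
under [RHS]eq_avg do rewrite expand.
rewrite avg_sum; apply: eq_bigr => g _.
transitivity (\prod_i W (g i) * \prod_y (\sum_(i | (g i).1 == y) (g i).2 == 0)%:R); last first.
  have -> : \prod_y (\sum_(i | (g i).1 == y) (g i).2 == 0)%:R =
      \prod_y avg (fun a : A => chi (red a * \sum_(i | (g i).1 == y) (g i).2)).
    by apply: eq_bigr => y _; rewrite chi_avg.
  rewrite -avg_prod -avgZ; apply: eq_avg => r; rewrite big_split/=; congr (_ * _).
  rewrite (partition_big (fun i => (g i).1) xpredT)//=; apply: eq_bigr => y _.
  by rewrite mulr_sumr -chi_prod; apply: eq_bigr => i /eqP ->.
have [->|W0] := eqVneq (\prod_i W (g i)) 0; first by rewrite !mul0r.
congr (_ * _); case: eqVneq => [h0|h0].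
  by rewrite big1// => y _; rewrite good// eqxx.
have [y hy] : exists y, \sum_(i | (g i).1 == y) (g i).2 != 0.
  apply/existsP; apply: contraR h0 => /existsPn h; apply/eqP.
  by rewrite (partition_big (fun i => (g i).1) xpredT)//= big1// => y _; apply/eqP; rewrite -[_ == _]negbK; exact: h.
by rewrite (bigD1 y)//= (negbTE hy) mul0r.
Qed.

End WordMoments.

Section RootCounts.
Variable F : finFieldType.
Hypothesis two0 : (2 : F) != 0.

Lemma nrootE (u : F) : nroot u = (\sum_(h : F) ((h ^+ 2 * u)%R == 1%R))%N.
Proof. by rewrite /nroot -sum1_card big_mkcond/=; apply: eq_bigr => h _; rewrite inE; case: (h ^+ 2 * u == 1). Qed.

Lemma card_nonzero : (\sum_(h : F) (h != 0%R) = #|F|.-1)%N.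
Proof.
transitivity #|[set~ (0 : F)]%SET|; last by rewrite cardsC1.
by rewrite -sum1_card [RHS]big_mkcond/=; apply: eq_bigr => h _; rewrite !inE; case: (h != 0).
Qed.

Lemma root_eq (h u x : F) : (h ^+ 2 * (u + x) == 1) = (h != 0) && (x == h^-1 ^+ 2 - u).
Proof.
have [->|h0] := eqVneq h 0; first by rewrite expr2 !mul0r eq_sym oner_eq0.
apply/eqP/eqP => [e|->]; last by rewrite addrCA subrr addr0 -exprMn divff// expr1n.
by apply: (mulfI (expf_neq0 2 h0)); rewrite mulrBr -exprMn divff// expr1n -e; ring.
Qed.

Lemma sum_nroot (u : F) : (\sum_(x : F) nroot (u + x)%R = #|F|.-1)%N.
Proof.
under eq_bigr do rewrite nrootE.
rewrite exchange_big/= -card_nonzero; apply: eq_bigr => h _.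
under eq_bigr do rewrite root_eq.
have [h0|h0] := eqVneq h 0; first by rewrite big1.
by rewrite (bigD1 (h^-1 ^+ 2 - u))//= eqxx big1// => x /negbTE ->.
Qed.

Lemma sum_nroot_sqr (u : F) : (\sum_(x : F) nroot (u + x)%R * nroot (u + x)%R <= 2 * #|F|.-1)%N.
Proof.
rewrite -(sum_nroot u) big_distrr/=; apply: leq_sum => x _.
by rewrite leq_mul2r nroot_le2 orbT.
Qed.

(** Eliminating [x] leaves [(h^-1 - k^-1) * (h^-1 + k^-1) = u - v]. The second factor is nonzero and
    determines the first, hence the pair, as 2 is invertible. *)
Lemma sum_nroot_mul (u v : F) : u != v -> (\sum_(x : F) nroot (u + x)%R * nroot (v + x)%R <= #|F|.-1)%N.
Proof.
move=> uv; pose E := [set hk : F * F | [&& hk.1 != 0, hk.2 != 0 & hk.1^-1 ^+ 2 - u == hk.2^-1 ^+ 2 - v]]%SET.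
have le1 : (\sum_(x : F) nroot (u + x)%R * nroot (v + x)%R <= #|E|)%N.
  under eq_bigr do rewrite !nrootE big_distrlr/=.
  rewrite exchange_big/=; under eq_bigr do rewrite exchange_big/=.
  rewrite pair_big/= -sum1_card [leqRHS]big_mkcond/=; apply: leq_sum => -[h k] _ /=.
  rewrite inE/=; under eq_bigr do rewrite !root_eq.
  have [h0|h0] := eqVneq h 0; first by rewrite big1.
  have [k0|k0] := eqVneq k 0; first by rewrite big1// => x _; rewrite muln0.
  case: eqVneq => [e|ne].
    by rewrite (bigD1 (h^-1 ^+ 2 - u))//= big1 ?addn0 => [|x /negbTE ->//]; do 2 case: (_ == _).
  rewrite big1// => x _; case: eqVneq => //= ->.
  by rewrite (negbTE ne).
apply: (leq_trans le1); pose f (hk : F * F) := hk.1^-1 + hk.2^-1.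
have fE hk : hk \in E -> f hk != 0 /\ (hk.1^-1 - hk.2^-1) * f hk = u - v.
  rewrite inE => /and3P[h0 k0 /eqP e].
  have e2 : (hk.1^-1 - hk.2^-1) * f hk = u - v.
    transitivity (hk.1^-1 ^+ 2 - u - (hk.2^-1 ^+ 2 - v) + (u - v)); first by rewrite /f; ring.
    by rewrite e subrr add0r.
  split=> //; apply: contra uv => /eqP f0; move/eqP: e2.
  by rewrite f0 mulr0 eq_sym subr_eq0.
have injf : {in E &, injective f}.
  move=> [h k] [h' k'] hE hE' ff; have [f0 e] := fE _ hE; have [_ e'] := fE _ hE'.
  have d : h^-1 - k^-1 = h'^-1 - k'^-1.
    by apply: (mulIf f0); transitivity (u - v); [exact: e|rewrite ff; exact: esym e'].
  have hh : h^-1 = h'^-1.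
    apply: (mulfI two0); transitivity (f (h, k) + (h^-1 - k^-1)); first by rewrite /f/=; ring.
    by rewrite d ff /f/=; ring.
  have kk : k^-1 = k'^-1.
    have : f (h, k) - h^-1 = f (h', k') - h'^-1 by rewrite ff hh.
    by rewrite /f/= ![_ + _ - _]addrAC !subrr !add0r.
  by rewrite (invr_inj hh) (invr_inj kk).
rewrite -(card_in_imset injf) -card_nonzero.
apply: leq_trans (subset_leq_card (_ : _ \subset [set~ (0 : F)]%SET)) _.
  by apply/fintype.subsetP => _ /imsetP[hk hE ->]; rewrite !inE; case: (fE _ hE).
rewrite -sum1_card [leqLHS]big_mkcond/=; apply: leq_sum => h _; by rewrite !inE; case: (h != 0).
Qed.

(** The main terms [M ^+ 2 * P] cancel when the square is expanded. The diagonal leaves [2 * M * P],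
    and [M ^+ 2] remains because [#|F|] is [P + 1]. *)
Lemma nroot_variance (R : realFieldType) (T : finType) (I : {set T}) (u : T -> F) :
  {in I &, injective u} ->
  \sum_(x : F) ((\sum_(y in I) (nroot (u y + x))%:R) - #|I|%:R) ^+ 2 <=
  2 * #|I|%:R * (#|F|.-1)%:R + #|I|%:R ^+ 2 :> R.
Proof.
move=> inju; set M : R := #|I|%:R; set P : R := (#|F|.-1)%:R.
have Pp : #|F|%:R = P + 1 :> R by rewrite natr1 prednK//; apply/card_gt0P; exists 0.
have s1 : \sum_(x : F) \sum_(y in I) (nroot (u y + x))%:R = M * P :> R.
  rewrite exchange_big/=; under eq_bigr do rewrite -natr_sum sum_nroot.
  by rewrite sumr_const mulr_natl.
have s2 : \sum_(x : F) (\sum_(y in I) (nroot (u y + x))%:R) ^+ 2 <= 2 * M * P + M * M * P :> R.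
  under eq_bigr do rewrite expr2 big_distrlr/=.
  rewrite exchange_big/=; under eq_bigr do rewrite exchange_big/=.
  apply: (@le_trans _ _ (\sum_(y in I) \sum_(z in I) ((y == z)%:R * (2 * P) + P))).
    apply: ler_sum => y yI; apply: ler_sum => z zI.
    under eq_bigr do rewrite -natrM.
    rewrite -natr_sum; have [->|yz] := eqVneq y z.
      rewrite mul1r; apply: (@le_trans _ _ (2 * P)); last by rewrite lerDl.
      by rewrite -natrM ler_nat sum_nroot_sqr.
    by rewrite mul0r add0r ler_nat sum_nroot_mul// (inj_in_eq inju).
  under eq_bigr => y yI.
    rewrite big_split/= (bigD1 y)//= eqxx mul1r big1 ?addr0; last first.
      by move=> z /andP[_ /negbTE zy]; rewrite eq_sym zy mul0r.
    rewrite sumr_const -mulr_natl -/M.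
    over.
  by rewrite sumr_const -mulr_natl -/M le_eqVlt; apply/orP; left; apply/eqP; ring.
have -> : \sum_(x : F) ((\sum_(y in I) (nroot (u y + x))%:R) - M) ^+ 2 =
    \sum_(x : F) (\sum_(y in I) (nroot (u y + x))%:R) ^+ 2
      - 2 * M * (\sum_(x : F) \sum_(y in I) (nroot (u y + x))%:R) + M ^+ 2 * (P + 1) :> R.
  have -> : M ^+ 2 * (P + 1) = \sum_(x : F) M ^+ 2 by rewrite sumr_const -Pp mulr_natr.
  by rewrite mulr_sumr -sumrB -big_split/=; apply: eq_bigr => x _; ring.
rewrite s1; move: s2; set X := \sum_(x : F) _; lra.
Qed.

End RootCounts.

Lemma expRN_dist (R : realType) (u v : R) : 0 <= u -> 0 <= v ->
  `|expR (- u) - expR (- v)| <= `|u - v|.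
Proof.
wlog uv : u v / u <= v => [hw u0 v0|u0 v0].
  have [|/ltW] := leP u v; first by move=> /hw; apply.
  by move=> /hw h; rewrite distrC [leRHS]distrC; exact: h.
have e1 : expR (- v) <= expR (- u) by rewrite ler_expR lerN2.
rewrite ger0_norm ?subr_ge0// ler0_norm ?subr_le0// opprB.
have h : expR (- v) = expR (- u) * expR (- (v - u)) by rewrite -expRD; congr expR; ring.
have h1 := expR_ge1Dx (- (v - u)).
have h2 : expR (- u) <= 1 by rewrite -expR0 ler_expR oppr_le0.
have h3 := expR_gt0 (- u); rewrite h; nra.
Qed.

Section UnitSums.
Variables (p n : nat).
Hypotheses (pp : prime p) (n2 : (2 <= n)%N).
Local Notation q := (p ^ n)%N.
Local Notation A := ('Z_q).
Local Notation T := (unitsZ q).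
Local Notation red := (@red p n).
Local Notation pi := (ppi p n).
Variable R : realType.

Lemma sum_unitsZ (V : nmodType) (f : A -> V) :
  \sum_(x : T) f (unitZ_val x) = \sum_(z : A | red z != 0) f z.
Proof.
rewrite [RHS](reindex_omap (fun x : {unit A} => FinRing.uval x) (insub : A -> option {unit A})).
  apply: eq_bigl => x; rewrite -red_unit//.
  by rewrite (_ : FinRing.uval x \is a GRing.unit) ?valK ?eqxx//; exact: (valP x).
by move=> z; rewrite -red_unit// => uz; rewrite insubT.
Qed.

(** Since [pi] reduces to 0, each translation by [pi * a] permutes the units. *)
Lemma avg_shift (f : A -> R) :
  avg (fun x : T => f (unitZ_val x)) =
  avg (fun x : T => avg (fun a : A => f (unitZ_val x + pi * a))).
Proof.
have A0 : (0 < #|A|)%N by rewrite card_ord.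
rewrite avg_exchange.
rewrite -[LHS](@avg_cst _ A)//; apply: eq_avg => a; congr (_ * _).
rewrite sum_unitsZ (sum_unitsZ (fun z => f (z + pi * a))) (reindex_inj (addIr (pi * a)))/=.
by apply: eq_bigl => z; rewrite redD// redM// red_ppi// mul0r addr0.
Qed.

Lemma sum_units_red (g : 'F_p -> R) :
  \sum_(x : T) g (red (unitZ_val x)) = (p ^ n.-1)%:R * \sum_(x0 : 'F_p | x0 != 0) g x0.
Proof.
rewrite (sum_unitsZ (fun z => g (red z))) (partition_big red (fun x0 => x0 != 0))//= mulr_sumr.
apply: eq_bigr => x0 x00; rewrite (eq_bigr (fun=> g x0)) => [|z /andP[_ /eqP ->]//].
rewrite (eq_bigl (fun z => red z == x0)) => [|z]; last by rewrite andb_idl// => /eqP ->.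
by rewrite sumr_const -cardsE card_red// mulr_natl.
Qed.

Lemma card_unitsZ : #|{: T}|%:R = (p ^ n.-1)%:R * (p.-1)%:R :> R.
Proof.
have := sum_units_red (fun=> 1); rewrite sumr_const => ->; congr (_ * _).
rewrite sumr_const; congr (_%:R); rewrite -[in RHS](card_Fp pp) -card_nonzero -sum1_card big_mkcond/=.
by apply: eq_bigr => h _; rewrite unfold_in; case: (h != 0).
Qed.

Lemma avg_units_red (g : 'F_p -> R) : (forall x0, 0 <= g x0) ->
  avg (fun x : T => g (red (unitZ_val x))) <= (p.-1)%:R^-1 * \sum_(x0 : 'F_p) g x0.
Proof.
move=> g0; rewrite /avg sum_units_red card_unitsZ invfM mulrACA mulVf ?mul1r; last first.
  by rewrite pnatr_eq0 -lt0n expn_gt0 prime_gt0.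
rewrite ler_wpM2l ?invr_ge0// [leRHS](bigID (fun x0 => x0 != 0))/= lerDl.
by apply: sumr_ge0 => *; exact: g0.
Qed.

End UnitSums.

(** * Estimates for a fixed prime *)

Section FixedModulus.
Variables (R : realType) (p n : nat).
Hypotheses (pp : prime p) (op : odd p) (n2 : (2 <= n)%N).
Local Notation q := (p ^ n)%N.
Local Notation A := ('Z_q).
Local Notation T := (unitsZ q).
Local Notation red := (@red p n).
Local Notation pi := (ppi p n).
Local Notation kl b := (Kl R p n (nat_of_ord (b : A)%R)%:Z).
Variable I : {set T}.
Hypothesis hI : forall x y : T, x \in I -> y \in I -> x <> y ->
  ~ (p %| nat_of_ord (unitZ_val x - unitZ_val y)%R)%N.

Lemma red_unit_inj : {in I &, injective (fun y => red (unitZ_val y))}.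
Proof.
move=> x y xI yI /= /eqP; rewrite -subr_eq0 -redB// red_eq0// => h.
by apply: contrapT => xy; exact: (hI xI yI xy h).
Qed.

(** Stated on all of [A], so that translated arguments need not be repackaged as units. *)
Definition sumKlZ (z : A) : R := (Num.sqrt #|I|%:R)^-1 * \sum_(y in I) kl (unitZ_val y + z).

Definition bad_words (j : nat) : {set 'F_p} :=
  [set x : 'F_p | [exists y : {ffun 'I_j -> T}, (y \in ffun_on (mem I)) &&
      (x \in bad_pts (fun i => red (unitZ_val (y i))))]]%SET.

Definition bad_set (k : nat) : {set 'F_p} := [set x : 'F_p | [exists j : 'I_k.+1, x \in bad_words j]]%SET.

Lemma card_bad_words j : (#|bad_words j| <= #|I| ^ j * relation_const j)%N.
Proof.
pose B (y : {ffun 'I_j -> T}) := if y \in ffun_on (mem I) then bad_pts (fun i => red (unitZ_val (y i))) else finset.set0.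
apply: (@leq_trans (\sum_y #|B y|)%N).
  by apply: card_cover => x; rewrite inE => /existsP[y /andP[yI xy]]; exists y; rewrite /B yI.
apply: (@leq_trans (\sum_(y in ffun_on (mem I)) relation_const j)%N).
  rewrite [leqRHS]big_mkcond/=; apply: leq_sum => y _; rewrite /B; case: ifP => _; last by rewrite cards0.
  exact: card_bad_pts.
by rewrite sum_nat_const card_ffun_on card_ord.
Qed.

Lemma card_bad_set k : (0 < #|I|)%N ->
  (#|bad_set k| <= #|I| ^ k * \sum_(j < k.+1) relation_const j)%N.
Proof.
move=> I0; apply: (@leq_trans (\sum_(j < k.+1) #|bad_words j|)%N).
  by apply: card_cover => x; rewrite inE => /existsP[j xj]; exists j.
rewrite big_distrr/=; apply: leq_sum => j _; apply: leq_trans (card_bad_words j) _.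
by rewrite leq_mul2r leq_pexp2l ?orbT// -ltnS.
Qed.

Section FixedPoint.
Variables (s : R) (z : A) (k : nat).
Hypotheses (ek : ~~ odd k) (zgood : red z \notin bad_set k) (s8 : 2 * `|s| <= 1 / 4).

Let Z (y : T) (a : A) : R := if y \in I then s * kl (unitZ_val y + z + pi * a) else 0.
Let b (y : T) : R := if y \in I then 2 * `|s| else 0.

Let W (w : T * 'F_p) : R[i] :=
  if (w.1 \in I) && (w.2 ^+ 2 * red (unitZ_val w.1 + z) == 1)
  then s%:C%C * klcoef R w.2 (unitZ_val w.1 + z) else 0.

Let ZW (r : T -> A) : (\sum_y Z y (r y))%:C%C = \sum_w W w * chi R n (red (r w.1) * w.2).
Proof.
rewrite rmorph_sum -(pair_big xpredT xpredT (fun y h => W (y, h) * chi R n (red (r y) * h)))/=.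
apply: eq_bigr => y _; rewrite /Z; case yI: (y \in I); last first.
  by rewrite big1// => h _; rewrite /W/= yI mul0r.
transitivity (s%:C%C * (kl (unitZ_val y + z + pi * r y))%:C%C); first by rewrite -rmorphM.
rewrite Kl_shift// mulr_sumr big_mkcond; apply: eq_bigr => h _.
by rewrite /W/= yI/=; case: ifP => _; rewrite ?mul0r ?mulrA.
Qed.

(** A word of nonzero weight is a choice of elements of [I] together with critical points; as
    [red z] is not exceptional, any additive relation among these points is trivial. *)
Let moments j : (j <= k)%N ->
  avg (fun a : A => (\sum_y Z y a) ^+ j) = avg (fun r : {ffun T -> A} => (\sum_y Z y (r y)) ^+ j).
Proof.
move=> jk.
suff : (avg (fun a : A => (\sum_y Z y a) ^+ j))%:C%C =
    (avg (fun r : {ffun T -> A} => (\sum_y Z y (r y)) ^+ j))%:C%C :> R[i].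
  by move/(fmorph_inj (real_complex R)).
rewrite !real_complex_avg.
transitivity (avg (fun a : A => (\sum_w W w * chi R n (red a * w.2)) ^+ j)).
  by apply: eq_avg => a; rewrite -(ZW (fun=> a)); exact: (rmorphXn (real_complex R)).
rewrite word_moments//; first by apply: eq_avg => r; rewrite -ZW; apply/esym; exact: (rmorphXn (real_complex R)).
move=> g /prodf_neq0 gW gs y0.
have gP i : ((g i).1 \in I) /\ (g i).2 ^+ 2 * (red (unitZ_val (g i).1) + red z) = 1.
  have := gW i isT; rewrite /W redD//; case: ((g i).1 \in I) => //=; last by rewrite eqxx.
  by case: ifP => [/eqP h _|_]; [split|rewrite eqxx].
case: (pickP [pred i | (g i).1 == y0]) => [i0 /= /eqP i0y|none]; last by rewrite big_pred0.
have : red z \notin bad_words j.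
  by apply: contra zgood => h; rewrite inE; apply/existsP; exists (Ordinal (jk : (j < k.+1)%N)).
rewrite inE negb_exists => /forallP/(_ [ffun i => (g i).1]); rewrite negb_and => /orP[|].
  by move=> /negP[]; apply/ffun_onP => i; rewrite ffunE; case: (gP i).
rewrite inE negb_exists => /forallP/(_ [ffun i => (g i).2]); rewrite !negb_and => /or3P[| |].
- by case/negP; apply/forallP => i; rewrite !ffunE (gP i).2 eqxx.
- by case/eqP; rewrite -[RHS]gs; apply: eq_bigr => i _; rewrite ffunE.
rewrite negb_exists => /forallP/(_ i0); rewrite negbK => /eqP h.
rewrite -[RHS]h; apply: eq_big => i; last by rewrite ffunE.
(* Relations are grouped by residue modulo [p], words by element of [I]: the separation hypothesis
   on [I] makes these groupings agree. *)
rewrite !ffunE -i0y; apply/eqP/eqP => [->//|]; apply: red_unit_inj; [exact: (gP i).1|exact: (gP i0).1].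
Qed.

Let A0 : (0 < #|A|)%N. Proof. by rewrite card_ord. Qed.

Let Zb y a : `|Z y a| <= b y.
Proof.
rewrite /Z /b; case: ifP => _; last by rewrite normr0.
by rewrite normrM mulrC ler_wpM2r// Kl_shift_le2.
Qed.

Let b4 y : b y <= 1 / 4.
Proof. by rewrite /b; case: ifP => // _; lra. Qed.

Let Z0 y : avg (Z y) = 0.
Proof.
rewrite /Z; case: (y \in I); last by rewrite avg_cst.
by rewrite avgZ /avg Kl_shift_sum// !mulr0.
Qed.

Let var y : avg (fun a => Z y a ^+ 2) =
  if y \in I then s ^+ 2 * (nroot (red (unitZ_val y) + red z))%:R else 0.
Proof.
rewrite /Z; case: (y \in I); last by rewrite expr0n avg_cst.
under eq_avg do rewrite exprMn.
rewrite avgZ; congr (_ * _); rewrite /avg Kl_shift_sum_sqr// redD// card_ord Zp_cast; last exact: q_gt1.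
by rewrite mulKf// pnatr_eq0 -lt0n ltnW// q_gt1.
Qed.

Let sumb (j : nat) : \sum_y b y ^+ j.+1 = #|I|%:R * (2 * `|s|) ^+ j.+1.
Proof.
rewrite (eq_bigr (fun y => if y \in I then (2 * `|s|) ^+ j.+1 else 0)).
  by rewrite -big_mkcond sumr_const [RHS]mulr_natl.
by move=> y _; rewrite /b; case: ifP => // _; rewrite expr0n.
Qed.

Let sumZ a : \sum_y Z y a = s * \sum_(y in I) kl (unitZ_val y + (z + pi * a)).
Proof.
rewrite mulr_sumr [RHS]big_mkcond; apply: eq_bigr => y _.
by rewrite /Z addrA.
Qed.

Lemma local_cf (c : R) :
  `|avg (fun a : A => cos (c + s * \sum_(y in I) kl (unitZ_val y + (z + pi * a)))) -
    cos c * expR (- (s ^+ 2 / 2 * \sum_(y in I) (nroot (red (unitZ_val y) + red z))%:R))| <=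
  4 / 2 ^+ k * expR (8 * (#|I|%:R * (2 * `|s|) ^+ 2)) + #|I|%:R * (2 * `|s|) ^+ 3.
Proof.
have := moment_model_cos A0 Zb b4 Z0 ek moments c; rewrite !sumb.
under eq_avg do rewrite sumZ.
under eq_bigr do rewrite var.
congr (`|_ - _ * expR (- _)| <= _).
rewrite mulr_sumr [RHS]big_mkcond/=; apply: eq_bigr => y _.
by case: ifP => _; rewrite ?mul0r// mulrAC.
Qed.

Lemma local_moment :
  avg (fun a : A => (s * \sum_(y in I) kl (unitZ_val y + (z + pi * a))) ^+ k) <=
  2 * (k`!)%:R / 2 ^+ k * expR (8 * (#|I|%:R * (2 * `|s|) ^+ 2)).
Proof.
have := model_moment A0 Zb b4 Z0 ek; rewrite -moments// sumb.
by under eq_avg do rewrite sumZ.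
Qed.

End FixedPoint.

Hypothesis I0 : (0 < #|I|)%N.
Let M : R := #|I|%:R.
Let M0 : 0 < M. Proof. by rewrite /M ltr0n. Qed.
Let sqM : Num.sqrt M ^+ 2 = M. Proof. by rewrite sqr_sqrtr// ltW. Qed.
Let sqM0 : 0 < Num.sqrt M. Proof. by rewrite sqrtr_gt0. Qed.
Let P0 : 0 < (p.-1)%:R :> R. Proof. by rewrite ltr0n; have := prime_gt1 pp; lia. Qed.

Definition bad_const (k : nat) : R := (\sum_(j < k.+1) relation_const j)%:R.

Lemma avg_bad (k : nat) :
  avg (fun x : T => (red (unitZ_val x) \in bad_set k)%:R) <= bad_const k * M ^+ k / (p.-1)%:R.
Proof.
apply: le_trans (avg_units_red pp n2 (g := fun x0 => (x0 \in bad_set k)%:R) _) _ => //.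
rewrite mulrC ler_wpM2r ?invr_ge0// -natr_sum /bad_const /M -natrX -natrM ler_nat.
have -> : (\sum_(x0 : 'F_p) (x0 \in bad_set k) = #|bad_set k|)%N.
  by rewrite -sum1_card [RHS]big_mkcond/=; apply: eq_bigr => x0 _; case: (x0 \in bad_set k).
by rewrite mulnC card_bad_set.
Qed.

Let N (z : A) : R := \sum_(y in I) (nroot (red (unitZ_val y) + red z))%:R.

Lemma avg_variance : avg (fun x : T => (N (unitZ_val x) / M - 1) ^+ 2) <= 2 / M + (p.-1)%:R^-1.
Proof.
pose g (x0 : 'F_p) : R := ((\sum_(y in I) (nroot (red (unitZ_val y) + x0))%:R) / M - 1) ^+ 2.
apply: le_trans (avg_units_red pp n2 (g := g) _) _; first by move=> x0; exact: sqr_ge0.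
have two0 : (2 : 'F_p) != 0.
  rewrite natF_eq0//; apply/negP => /(dvdn_leq (isT : (0 < 2)%N)) p2.
  by have := prime_gt1 pp; move: op p2; case: (p) => [|[|[|]]].
have := @nroot_variance 'F_p two0 R T I _ red_unit_inj; rewrite card_Fp// -/M => h.
have -> : \sum_x0 g x0 = M ^- 2 * \sum_(x0 : 'F_p)
    ((\sum_(y in I) (nroot (red (unitZ_val y) + x0))%:R) - M) ^+ 2.
  rewrite mulr_sumr; apply: eq_bigr => x0 _; rewrite /g.
  by move: (\sum_(y in I) _) => u; field; rewrite gt_eqF.
have -> : 2 / M + (p.-1)%:R^-1 = (p.-1)%:R^-1 * (M ^- 2 * (2 * M * (p.-1)%:R + M ^+ 2)) :> R.
  by move: P0; move: (p.-1)%:R => u u0; field; rewrite !gt_eqF.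
by rewrite ler_wpM2l ?invr_ge0// ler_wpM2l// invr_ge0 sqr_ge0.
Qed.

(** The three groups of errors come from the exceptional residues, where the difference is at most
    2, from the comparison at a good point, and from the fluctuation of the local variance. The free
    parameter [d] bounds a mean absolute deviation by a variance. *)
Lemma unit_cf (l c d : R) (k : nat) : ~~ odd k -> 0 < d -> 2 * `|l| / Num.sqrt M <= 1 / 4 ->
  `|avg (fun x : T => cos (c + l * sumKl R I x)) - cos c * expR (- (l ^+ 2 / 2))| <=
  2 * (bad_const k * M ^+ k / (p.-1)%:R) +
  (4 / 2 ^+ k * expR (32 * l ^+ 2) + 8 * `|l| ^+ 3 / Num.sqrt M) +
  l ^+ 2 / 2 * (d / 2 + (2 / M + (p.-1)%:R^-1) / (2 * d)).
Proof.
move=> ek d0 l8; pose s := l / Num.sqrt M.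
have ns : `|s| = `|l| / Num.sqrt M by rewrite normrM normfV (gtr0_norm sqM0).
have T0 : (0 < #|{: T}|)%N by apply/card_gt0P; exists point.
have A0 : (0 < #|A|)%N by rewrite card_ord.
pose B : R := 4 / 2 ^+ k * expR (32 * l ^+ 2) + 8 * `|l| ^+ 3 / Num.sqrt M.
have B0 : 0 <= B.
  by rewrite addr_ge0// ?divr_ge0 ?mulr_ge0 ?expR_ge0 ?invr_ge0 ?exprn_ge0// ltW.
have key (z : A) : `|avg (fun a : A => cos (c + l * sumKlZ (z + pi * a))) - cos c * expR (- (l ^+ 2 / 2))| <=
    2 * (red z \in bad_set k)%:R + (B + l ^+ 2 / 2 * (d / 2 + (N z / M - 1) ^+ 2 / (2 * d))).
  have V0 : 0 <= l ^+ 2 / 2 * (d / 2 + (N z / M - 1) ^+ 2 / (2 * d)).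
    by rewrite mulr_ge0 ?divr_ge0 ?sqr_ge0// addr_ge0 ?divr_ge0 ?sqr_ge0 ?mulr_ge0// ltW.
  have [zb|zg] := boolP (red z \in bad_set k).
    apply: (@le_trans _ _ 2); last by rewrite mulr1 lerDl addr_ge0.
    apply: le_trans (ler_normB _ _) _; rewrite -[2]/(1 + 1); apply: lerD.
      apply: le_trans (ler_norm_avg _) _; rewrite -[leRHS](@avg_cst R A)//.
      by apply: le_avg => a; rewrite ler_norml cos_geN1 cos_le1.
    rewrite normrM mulr_ile1//; first by rewrite ler_norml cos_geN1 cos_le1.
    by rewrite ger0_norm ?expR_ge0// -expR0 ler_expR oppr_le0 divr_ge0 ?sqr_ge0.
  rewrite mulr0 add0r.
  have s8 : 2 * `|s| <= 1 / 4 by rewrite ns mulrA.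
  have := local_cf ek zg s8 c.
  have -> : #|I|%:R * (2 * `|s|) ^+ 2 = 4 * l ^+ 2.
    rewrite ns -/M exprMn expr_div_n sqM real_normK ?num_real//; field.
    by rewrite gt_eqF.
  have -> : #|I|%:R * (2 * `|s|) ^+ 3 = 8 * `|l| ^+ 3 / Num.sqrt M.
    rewrite ns -/M -{1}sqM; move: sqM0; move: (Num.sqrt M) => m m0; field.
    by rewrite gt_eqF.
  rewrite (_ : 8 * (4 * l ^+ 2) = 32 * l ^+ 2); last by ring.
  rewrite -/B; under eq_avg => a.
    rewrite (_ : s * _ = l * sumKlZ (z + pi * a)); last by rewrite /sumKlZ mulrA.
    over.
  set a1 := avg _ => h1.
  have h2 : `|cos c * expR (- (s ^+ 2 / 2 * N z)) - cos c * expR (- (l ^+ 2 / 2))| <=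
      l ^+ 2 / 2 * (d / 2 + (N z / M - 1) ^+ 2 / (2 * d)).
    have N0 : 0 <= N z by apply: sumr_ge0.
    rewrite -mulrBr normrM; apply: le_trans (_ : `|l ^+ 2 / 2 * (N z / M - 1)| <= _).
      apply: le_trans (_ : 1 * `|s ^+ 2 / 2 * N z - l ^+ 2 / 2| <= _).
        apply: ler_pM => //; first by rewrite ler_norml cos_geN1 cos_le1.
        apply: expRN_dist; last by apply: divr_ge0 => //; exact: sqr_ge0.
        by apply: mulr_ge0 => //; apply: divr_ge0 => //; exact: sqr_ge0.
      rewrite mul1r le_eqVlt; apply/orP; left; apply/eqP; congr `|_|.
      by rewrite /s expr_div_n sqM; field; rewrite gt_eqF.
    rewrite normrM ger0_norm ?divr_ge0 ?sqr_ge0// ler_wpM2l ?divr_ge0 ?sqr_ge0//.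
    (* AM-GM: [u <= d / 2 + u ^+ 2 / (2 * d)] *)
    rewrite -[(N z / M - 1) ^+ 2]real_normK ?num_real//; set u := `|_|.
    have -> : d / 2 + u ^+ 2 / (2 * d) = u + (u - d) ^+ 2 / (2 * d) by field; rewrite gt_eqF.
    by rewrite lerDl divr_ge0 ?sqr_ge0 ?mulr_ge0// ltW.
  rewrite (_ : a1 - cos c * expR (- (l ^+ 2 / 2)) = (a1 - cos c * expR (- (s ^+ 2 / 2 * N z))) +
     (cos c * expR (- (s ^+ 2 / 2 * N z)) - cos c * expR (- (l ^+ 2 / 2)))); last by ring.
  by apply: le_trans (ler_normD _ _) _; exact: lerD.
have -> : avg (fun x : T => cos (c + l * sumKl R I x)) =
    avg (fun x : T => avg (fun a : A => cos (c + l * sumKlZ (unitZ_val x + pi * a)))).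
  exact: (avg_shift pp n2 (fun z => cos (c + l * sumKlZ z))).
rewrite -[cos c * _](@avg_cst R T)// -avgB; apply: le_trans (ler_norm_avg _) _.
apply: le_trans (le_avg (fun x : T => key (unitZ_val x))) _.
rewrite !avgD !avgZ avg_cst// avgD avg_cst// -[leRHS]addrA; apply: lerD.
  by rewrite ler_wpM2l// avg_bad.
rewrite lerD2l ler_wpM2l ?divr_ge0 ?sqr_ge0// avg_cst// lerD2l.
under eq_avg do rewrite mulrC.
by rewrite avgZ mulrC ler_wpM2r ?invr_ge0 ?mulr_ge0 ?(ltW d0)// avg_variance.
Qed.

(** Markov's inequality for the second moment, with [k = 2] and [s] the inverse of [Num.sqrt M];
    [64 <= M] is the condition [2 * s <= 1 / 4]. *)
Lemma unit_tail (L : R) : 0 < L -> 64 <= M ->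
  avg (fun x : T => (L < `|sumKl R I x|)%R%:R) <= bad_const 2 * M ^+ 2 / (p.-1)%:R + expR 32 / L ^+ 2.
Proof.
move=> L0 M64; pose s := (Num.sqrt M)^-1.
have T0 : (0 < #|{: T}|)%N by apply/card_gt0P; exists point.
have A0 : (0 < #|A|)%N by rewrite card_ord.
have s0 : 0 < s by rewrite invr_gt0.
have s8 : 2 * `|s| <= 1 / 4.
  rewrite gtr0_norm// /s -ler_pdivlMl// (_ : 2^-1 * (1 / 4) = 8^-1); last by field.
  have h8 : 8 <= Num.sqrt M.
    by rewrite -[8]gtr0_norm// -sqrtr_sqr ler_wsqrtr// expr2; lra.
  by rewrite lef_pV2 ?posrE.
have key (z : A) : avg (fun a : A => (L < `|sumKlZ (z + pi * a)|)%R%:R) <=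
    (red z \in bad_set 2)%:R + expR 32 / L ^+ 2.
  have E0 : 0 <= expR 32 / L ^+ 2 by rewrite divr_ge0 ?expR_ge0 ?sqr_ge0.
  have [zb|zg] := boolP (red z \in bad_set 2).
    apply: (@le_trans _ _ 1); last by rewrite lerDl.
    by rewrite -[leRHS](@avg_cst R A)//; apply: le_avg => a; case: (_ < _).
  rewrite add0r; have := @local_moment s z 2 isT zg s8.
  have -> : #|I|%:R * (2 * `|s|) ^+ 2 = 4.
    rewrite gtr0_norm// /s exprMn exprVn sqM -/M; field.
    by rewrite gt_eqF.
  rewrite (_ : 8 * 4 = 32); last by ring.
  rewrite (_ : 2 * _ / _ * _ = expR 32) => [h|]; last first.
    by rewrite -[(2`!)%N]/2%N; field.
  rewrite ler_pdivlMr ?exprn_gt0//; apply: le_trans h; rewrite mulrC -avgZ.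
  apply: le_avg => a; rewrite -/(sumKlZ _); case: ltP => hL; rewrite ?mulr1 ?mulr0 ?sqr_ge0//.
  by rewrite -[leRHS]real_normK ?num_real// ler_pXn2r ?nnegrE ?(ltW L0) ?(ltW hL).
have -> : avg (fun x : T => (L < `|sumKl R I x|)%R%:R) =
    avg (fun x : T => avg (fun a : A => (L < `|sumKlZ (unitZ_val x + pi * a)|)%R%:R)) :> R.
  exact: (avg_shift pp n2 (fun z : A => (L < `|sumKlZ z|)%R%:R : R)).
apply: le_trans (le_avg (fun x : T => key (unitZ_val x))) _.
by rewrite avgD avg_cst// lerD2r avg_bad.
Qed.

End FixedModulus.

Lemma integral_uniform_units (R : realType) (q : nat) (g : unitsZ q -> R) :
  (\int[@uniform_units R q]_x (g x)%:E = (avg g)%:E)%E.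
Proof.
have -> : [set: unitsZ q] = \big[setU/set0]_(i <- enum {: unitsZ q}) [set i].
  apply/seteqP; split => // x _; rewrite -bigcup_seq; exists x => //=.
  by rewrite mem_enum.
rewrite integral_bigsetU_EFin//; last 2 first.
- exact: enum_uniq.
- by apply/trivIsetP => i j _ _ ij; apply/seteqP; split => x //= [-> /eqP]; rewrite (negbTE ij).
rewrite big_enum/= (eq_bigr (fun i => ((#|{: unitsZ q}|%:R)^-1 * g i)%:E)) => [|i _].
  by rewrite sumEFin /avg mulr_sumr.
rewrite (eq_integral (cst (g i)%:E)) => [|x]; last by rewrite inE => ->.
have mi : @uniform_units R q [set i] = (#|{: unitsZ q}|%:R^-1)%:E.
  by rewrite /uniform_units /mscale/= /counting asboolT// fset_set1 finmap.cardfs1 mule1.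
by rewrite integral_cst// [X in (_ * X)%E]mi -EFinM mulrC.
Qed.

Lemma expectation_normal01 (R : realType) (f : R -> R) (C : R) :
  continuous f -> (forall x, `|f x| <= C) ->
  ('E_(normal_prob (0 : R) 1)[f] = (\int[@lebesgue_measure R]_x (f x * gauss x))%:E)%E.
Proof.
move=> cf fC; rewrite unlock integral_normal01; last first.
  apply: measurable_bounded_integrable => //.
  - by rewrite (le_lt_trans (probability_le1 _ _))// ltry.
  - exact: continuous_measurable_fun.
  - by exists C; split; [exact: num_real|move=> M CM x _; apply: le_trans (fC x) _; exact: ltW].
rewrite /Rintegral fineK//; apply: integrable_fin_num => //.
exact: integrable_gauss_bounded fC.
Qed.

(** * Passage to the limit along the odd primes *)

Section Limits.
Variables (R : realType) (n : nat) (I : forall p : nat, {set unitsZ (p ^ n)}).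
Hypothesis hcard : #|I p| @[p --> odd_primes_oo] --> \oo.
Hypothesis hlog : (fun p : nat => ln (#|I p|%:R : R)) =o_odd_primes_oo
          (fun p : nat => ln (p%:R : R)).
Local Notation M p := (#|I p|%:R : R).

Lemma near_odd_prime : \forall p \near odd_primes_oo, prime p /\ odd p.
Proof.
by rewrite near_withinE; apply: filterE => p /andP[].
Qed.

Lemma near_card (x : R) : \forall p \near odd_primes_oo, x <= M p.
Proof.
have h0 : \forall p \near odd_primes_oo, ((Num.trunc x).+1 <= #|I p|)%N := hcard (nbhs_infty_ge _).
near=> p; have h : ((Num.trunc x).+1 <= #|I p|)%N by near: p.
by apply: le_trans (ltW (truncnS_gt x)) _; rewrite ler_nat.
Unshelve. all: by end_near. Qed.

(** The logarithmic hypothesis enters here, with the constant [m.+1%:R^-1] in the little-o. *)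
Lemma near_card_exp (m : nat) : \forall p \near odd_primes_oo, M p ^+ m.+1 <= p%:R.
Proof.
have /eqoP/(_ (m.+1%:R^-1)) := hlog; rewrite invr_gt0 ltr0n => /(_ isT) h.
near=> p.
have M1 : 1 <= M p by near: p; exact: near_card.
have [pp _] : prime p /\ odd p by near: p; exact: near_odd_prime.
have p1 : 1 <= p%:R :> R by rewrite ler1n prime_gt0.
have : `|ln (M p)| <= m.+1%:R^-1 * `|ln (p%:R : R)| by near: p.
rewrite !ger0_norm ?ln_ge0// ler_pdivlMl ?ltr0n// mulr_natl -lnXn; last by lra.
by rewrite ler_ln ?posrE ?exprn_gt0//; lra.
Unshelve. all: by end_near. Qed.

Lemma near_card_inv (a eps : R) : 0 < eps -> \forall p \near odd_primes_oo, a / M p <= eps.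
Proof.
move=> eps0; near=> p.
have M1 : 1 <= M p by near: p; exact: near_card.
have aM : a / eps <= M p by near: p; exact: near_card.
by rewrite ler_pdivrMr; [rewrite mulrC -ler_pdivrMr|lra].
Unshelve. all: by end_near. Qed.

Lemma near_card_sqrt (a eps : R) : 0 <= a -> 0 < eps ->
  \forall p \near odd_primes_oo, a / Num.sqrt (M p) <= eps.
Proof.
move=> a0 eps0; near=> p.
have M1 : 1 <= M p by near: p; exact: near_card.
have aM : (a / eps) ^+ 2 <= M p by near: p; exact: near_card.
rewrite ler_pdivrMr ?sqrtr_gt0; last by lra.
rewrite mulrC -ler_pdivrMr// -[leLHS]ger0_norm ?divr_ge0 ?(ltW eps0)// -sqrtr_sqr.
exact: ler_wsqrtr.
Unshelve. all: by end_near. Qed.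

(** One spare power of [M p] gives the decay: the quotient is at most [2 * a / M p], as
    [p <= 2 * p.-1]. *)
Lemma near_card_exp_div (k : nat) (a eps : R) : 0 <= a -> 0 < eps ->
  \forall p \near odd_primes_oo, a * M p ^+ k / (p.-1)%:R <= eps.
Proof.
move=> a0 eps0; near=> p.
have M1 : 1 <= M p by near: p; exact: near_card.
have M0 : 0 < M p by exact: lt_le_trans M1.
have [pp _] : prime p /\ odd p by near: p; exact: near_odd_prime.
have Mp : M p ^+ k.+1 <= p%:R by near: p; exact: near_card_exp.
have aM : (2 * a) / M p <= eps by near: p; exact: near_card_inv.
have [P1 P2] : 1 <= (p.-1)%:R :> R /\ p%:R = (p.-1)%:R + 1 :> R.
  by have := prime_gt1 pp; case: (p) => [//|[//|m]] _; rewrite ler1n natr1.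
apply: le_trans aM; rewrite ler_pdivrMr; last by lra.
rewrite mulrAC ler_pdivlMr// -mulrA -exprSr; apply: le_trans (ler_wpM2l a0 Mp) _.
by rewrite P2; have := ler_wpM2l a0 P1; lra.
Unshelve. all: by end_near. Qed.

Hypothesis n2 : (2 <= n)%N.
Hypothesis hI : forall p : nat, prime p -> odd p ->
    forall x y : unitsZ (p ^ n), x \in I p -> y \in I p -> x <> y ->
      ~ (p %| nat_of_ord (unitZ_val x - unitZ_val y)%R)%N.

Lemma bad_const_ge0 k : 0 <= bad_const R k.
Proof. exact: ler0n. Qed.

Lemma ler_frac_addr1 (a c : R) : 0 <= a -> 0 <= c -> a * c / (a + 1) <= c.
Proof. by move=> a0 c0; rewrite ler_pdivrMr; [lra|rewrite ltr_wpDl]. Qed.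

Lemma sumKl_cf_cvg (l c : R) :
  avg (fun x : unitsZ (p ^ n) => cos (l * sumKl R (I p) x + c)) @[p --> odd_primes_oo] -->
  cos c * expR (- (l ^+ 2 / 2)).
Proof.
apply/cvgrPdist_le => eps eps0.
(* The order [k] is even and depends on [l] and [eps] only; already [2 ^ N > N] makes the Taylor
   error at most [eps / 5]. *)
pose N := (Num.trunc (20 * expR (32 * l ^+ 2) / eps)).+1; pose k := N.*2.
have ek : ~~ odd k by rewrite odd_double.
have l20 : 0 <= l ^+ 2 by exact: sqr_ge0.
have l21 : 0 < l ^+ 2 + 1 by lra.
(* This makes [l ^+ 2 / 2 * (d / 2)] at most [eps / 8]; the added 1 covers [l = 0]. *)
pose d := eps / 2 / (l ^+ 2 + 1).
have d0 : 0 < d by rewrite !divr_gt0.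
have kP : 4 / 2 ^+ k * expR (32 * l ^+ 2) <= eps / 5.
  have : 20 * expR (32 * l ^+ 2) / eps <= 2 ^+ k.
    apply: le_trans (ltW (truncnS_gt _)) _; rewrite -natrX ler_nat -/N.
    apply: leq_trans (ltnW (ltn_expl N (isT : (1 < 2)%N))) _.
    by rewrite leq_exp2l// /k -addnn leq_addr.
  move=> h; rewrite mulrAC ler_pdivrMr ?exprn_gt0//; move: h; rewrite ler_pdivrMr//; lra.
(* A common bound for [2 / M p] and the inverse of [p.-1], for which the variance term is at most
   [eps / 5]. *)
pose w := 2 * (d * eps / 5 / (l ^+ 2 + 1)).
have w0 : 0 < w by rewrite mulr_gt0// divr_gt0// divr_gt0// mulr_gt0.
have lower : l ^+ 2 / 2 * (d / 2) <= eps / 8.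
  have -> : d = eps / 2 / (l ^+ 2 + 1) by [].
  rewrite (_ : _ * _ = l ^+ 2 * (eps / 8) / (l ^+ 2 + 1)); last by field; rewrite gt_eqF.
  by rewrite ler_frac_addr1// divr_ge0// ltW.
near=> p.
have [pp op] : prime p /\ odd p by near: p; exact: near_odd_prime.
have M1 : 1 <= M p by near: p; exact: near_card.
have M0 : 0 < M p by exact: lt_le_trans M1.
have I0 : (0 < #|I p|)%N by rewrite -(ltr0n R).
have lM : 2 * `|l| / Num.sqrt (M p) <= 1 / 4.
  by near: p; apply: near_card_sqrt; [rewrite mulr_ge0|rewrite divr_gt0].
have h1 : bad_const R k * M p ^+ k / (p.-1)%:R <= eps / 10.
  by near: p; apply: near_card_exp_div; [exact: bad_const_ge0|rewrite divr_gt0].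
have h2 : 8 * `|l| ^+ 3 / Num.sqrt (M p) <= eps / 5.
  by near: p; apply: near_card_sqrt; [rewrite mulr_ge0// exprn_ge0|rewrite divr_gt0].
have h3 : 2 / M p <= w by near: p; exact: near_card_inv.
have h4 : 1 * M p ^+ 0 / (p.-1)%:R <= w by near: p; exact: near_card_exp_div.
rewrite expr0 !mul1r in h4.
have h5 : l ^+ 2 / 2 * ((2 / M p + (p.-1)%:R^-1) / (2 * d)) <= eps / 5.
  apply: (@le_trans _ _ (l ^+ 2 / 2 * ((w + w) / (2 * d)))).
    rewrite ler_wpM2l ?divr_ge0// ler_wpM2r//; first by rewrite invr_ge0 mulr_ge0// ltW.
    exact: lerD.
  rewrite (_ : _ * _ = l ^+ 2 * (eps / 5) / (l ^+ 2 + 1)); last by rewrite /w; field; rewrite !gt_eqF.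
  by rewrite ler_frac_addr1// divr_ge0// ltW.
have -> : avg (fun x : unitsZ (p ^ n) => cos (l * sumKl R (I p) x + c)) =
    avg (fun x : unitsZ (p ^ n) => cos (c + l * sumKl R (I p) x)).
  by apply: eq_avg => x; rewrite addrC.
rewrite distrC; apply: le_trans (unit_cf pp op n2 (hI pp op) I0 c ek d0 lM) _; rewrite mulrDr.
clear -eps0 h1 h2 h5 kP lower; lra.
Unshelve. all: by end_near. Qed.

Lemma sumKl_tight (eta : R) : 0 < eta -> exists L0 : R, forall L, L0 <= L ->
  \forall p \near odd_primes_oo,
    avg (fun x : unitsZ (p ^ n) => (L < `|sumKl R (I p) x|)%R%:R) <= eta.
Proof.
move=> eta0; exists (1 + 2 * expR 32 / eta) => L hL.
have E0 : 0 < 2 * expR 32 / eta :> R by rewrite divr_gt0 ?mulr_gt0 ?expR_gt0.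
have L0 : 0 < L by lra.
have tail : expR 32 / L ^+ 2 <= eta / 2.
  have h : 2 * expR 32 / eta <= L ^+ 2 by nra.
  rewrite ler_pdivrMr ?exprn_gt0//; move: h; rewrite ler_pdivrMr//; lra.
near=> p.
have [pp op] : prime p /\ odd p by near: p; exact: near_odd_prime.
have M64 : 64 <= M p by near: p; exact: near_card.
have I0 : (0 < #|I p|)%N by rewrite -(ltr0n R); lra.
have h1 : bad_const R 2 * M p ^+ 2 / (p.-1)%:R <= eta / 2.
  by near: p; apply: near_card_exp_div; [exact: bad_const_ge0|rewrite divr_gt0].
apply: le_trans (unit_tail pp op n2 (hI pp op) I0 L0 M64) _; lra.
Unshelve. all: by end_near. Qed.

End Limits.

Theorem theoremA (R : realType) (n : nat) (hn : (2 <= n)%N)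
  (I : forall p : nat, {set unitsZ (p ^ n)})
  (hI : forall p : nat, prime p -> odd p ->
    forall x y : unitsZ (p ^ n), x \in I p -> y \in I p -> x <> y ->
      ~ (p %| nat_of_ord (unitZ_val x - unitZ_val y)%R)%N)
  (hcard : #|I p| @[p --> odd_primes_oo] --> \oo)
  (hlog : (fun p : nat => ln (#|I p|%:R : R)) =o_odd_primes_oo
          (fun p : nat => ln (p%:R : R))) :
  cvg_in_law odd_primes_oo (fun p : nat => sumKl_RV R (I p))
    (normal_prob (0 : R) 1).
Proof.
move=> f cf [C0 [_ bf]].
(* The definition of [bounded_fun] gives a bound by every real strictly above [C0]. *)
have {bf} fC x : `|f x| <= C0 + 1 by apply: bf => //; lra.
rewrite (expectation_normal01 cf fC).
rewrite (_ : (fun p => _) = (fun p => (avg (fun x : unitsZ (p ^ n) => f (sumKl R (I p) x)))%:E)); last first.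
  by apply/funext => p; rewrite unlock integral_uniform_units.
apply: cvg_EFin; first by near=> p.
apply: (levy_continuity _ (sumKl_cf_cvg hcard hlog hn hI) (sumKl_tight hcard hlog hn hI) cf fC).
by move=> p; apply/card_gt0P; exists point.
Unshelve. all: by end_near. Qed.
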